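(* Let $\mathcal E$ be a model category, $\mathcal J$ a weak lattice, $\widetilde Y:\mathcal J\to\operatorname{ho}(\mathcal E)$ a functor, and $x\in\operatorname{Obj}\mathcal J$ with $|x|>n\ge k\ge 2$. Let $\widetilde Y^x_k:\mathcal J^x_k\to\operatorname{ho}(\mathcal E)$ be the restriction of $\widetilde Y$, let $Y_k:\partial\mathcal J^x_k\to\mathcal E$ be a Reedy fibrant functor lifting $\widetilde Y^x_k|_{\partial\mathcal J^x_k}$, and let $Y^x_{k-1}:\mathcal J^x_{k-1}\to\mathcal E$ be a functor lifting $\widetilde Y^x_k|_{\mathcal J^x_{k-1}}$ which agrees with $Y_k$ on $\partial\mathcal J^x_{k-1}$. Then there is a functor $Y^x_k:\mathcal J^x_k\to\mathcal E$ lifting $\widetilde Y^x_k$ and strictly extending both $Y_k$ and $Y^x_{k-1}$ if and only if the total higher homotopy operation $\langle Y^x_{k-1}\rangle$ vanishes.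
   Context: **Weak lattices.** A weak lattice is a connected Reedy indexing category $\mathcal J$ with finite Hom-sets and a degree function $|\cdot|:\operatorname{Obj}\mathcal J\to\mathbb N$ such that there are finitely many objects in each degree, all non-identity morphisms strictly decrease degree, and every object maps to at least one object of degree $0$. For $x\in\operatorname{Obj}\mathcal J$, $\mathcal J^x$ is the full subcategory on the objects $t$ with $\mathcal J(x,t)\ne\emptyset$. For $k<|x|$, $\mathcal J^x_k$ is the full subcategory of $\mathcal J^x$ on $x$ and all its objects of degree $\le k$, and $\partial\mathcal J^x_k$ is its full subcategory on all objects other than $x$. **Matching objects.** For a functor $Y$ defined on $\partial\mathcal J^x_k$, $\mathbf M^x_k$ is the limit of $(f:x\to s)\mapsto Y(s)$ over the category of morphisms in $\mathcal J$ from $x$ to objects of degree $\le k$ (morphisms: commuting triangles under $x$); $\operatorname{forget}:\mathbf M^x_k\to\prod_{|t|\le k}\prod_{\mathcal J(x,t)}Y(t)$ is the inclusion of the limit in the product. If $Y$ is defined on $\mathcal J^x_k$, then $\operatorname m^x_k:Y(x)\to\mathbf M^x_k$ is the canonical map. $Y$ is Reedy fibrant if each $\operatorname m^s_{|s|-1}:Y(s)\to\mathbf M^s_{|s|-1}$ is a fibration (for $|s|=0$: $Y(s)$ is fibrant). **Conventions.** A functor $Y$ into $\mathcal E$ lifts a functor into $\operatorname{ho}(\mathcal E)$ if it has the given composite with $\mathcal E\to\operatorname{ho}(\mathcal E)$. All objects $\widetilde Y(s)$ are both fibrant and cofibrant; in particular $Y(x):=Y^x_{k-1}(x)$ is cofibrant.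 So left and right homotopy coincide for the maps below, and are denoted $\sim$. We write $Y(t)$ for the common values of the given functors. **The data.** $\sigma^x_{<k}:Y(x)\to\prod_{|t|<k}\prod_{\mathcal J(x,t)}Y(t)$ has components $Y^x_{k-1}(f)$. $\sigma^x_k:Y(x)\to\prod_{|s|=k}\prod_{\mathcal J(x,s)}Y(s)$ is a fixed map whose component at $g:x\to s$ represents the class $\widetilde Y^x_k(g)$. For $|s|=k$, $\sigma^s_{<k}:Y(s)\to\prod_{|v|<k}\prod_{\mathcal J(s,v)}Y(v)$ has components $Y_k(f)$; it equals $\operatorname{forget}\circ\operatorname m^s_{k-1}$. The generalized diagonal $$\Psi:\prod_{|t|<k}\prod_{\mathcal J(x,t)}Y(t)\to\prod_{|s|=k}\prod_{\mathcal J(x,s)}\prod_{|v|<k}\prod_{\mathcal J(s,v)}Y(v)$$ has component at $(g:x\to s,\ f:s\to v)$ the projection onto the factor $Y(v)$ indexed by $f\circ g$. Let $\mathbf Q^x_{k-1}$ be the pullback of $\Psi$ and $\prod\operatorname{forget}:\prod_{|s|=k}\prod_{\mathcal J(x,s)}\mathbf M^s_{k-1}\to\prod_{|s|=k}\prod_{\mathcal J(x,s)}\prod_{|v|<k}\prod_{\mathcal J(s,v)}Y(v)$. Each $g:x\to s$ with $|s|=k$ induces $\rho(g):Y(x)\to\mathbf M^s_{k-1}$ with component $Y^x_{k-1}(f\circ g)$ at $f:s\to v$; the maps $\rho(g)$ together with $\sigma^x_{<k}$ induce $\eta_{k-1}:Y(x)\to\mathbf Q^x_{k-1}$. **The operation.**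 Factor $\Psi=\Psi'\circ\iota$, with $\iota$ a trivial cofibration into an object $F^1$ and $\Psi'$ a fibration. Let $F^2$ be the pullback of $\Psi'$ and $\prod\operatorname{forget}$, with projection $q:F^2\to F^1$, and let $\gamma:\mathbf Q^x_{k-1}\to F^2$ be the map induced by $\iota$. The total higher homotopy operation $\langle Y^x_{k-1}\rangle$ is the set of homotopy classes of maps $\theta:Y(x)\to F^2$ such that $q\circ\theta\sim\iota\circ\sigma^x_{<k}$ and $\Psi'\circ q\circ\theta=\big(\prod\sigma^s_{<k}\big)\circ\sigma^x_k$. It vanishes if it contains the class $[\gamma\circ\eta_{k-1}]$. *)

(* Defs.v *)
From Stdlib Require Import Arith Lia FinFun Relations.
From Stdlib Require Import Classical ClassicalEpsilon FunctionalExtensionality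
  PropExtensionality.

Set Implicit Arguments.
Unset Strict Implicit.

(** * Categories *)

Record Category := {
  ob :> Type;
  hom : ob -> ob -> Type;
  idm : forall X, hom X X;
  comp : forall X Y Z, hom Y Z -> hom X Y -> hom X Z;
  comp_idl : forall X Y (f : hom X Y), comp (idm Y) f = f;
  comp_idr : forall X Y (f : hom X Y), comp f (idm X) = f;
  comp_assoc : forall W X Y Z (h : hom Y Z) (g : hom X Y) (f : hom W X),
    comp h (comp g f) = comp (comp h g) f
}.
Arguments hom {_} _ _.
Arguments idm {_} _.
Arguments comp {_ _ _ _} _ _.
Notation "g ∘ f" := (comp g f) (at level 40, left associativity).

Record Functor (C D : Category) := {
  fobj :> C -> D;
  fmap : forall X Y, hom X Y -> hom (fobj X) (fobj Y);
  fmap_id : forall X, fmap (idm X) = idm (fobj X);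
  fmap_comp : forall X Y Z (g : hom Y Z) (f : hom X Y),
    fmap (g ∘ f) = fmap g ∘ fmap f
}.
Arguments fmap {_ _} _ {_ _} _.

Definition functor_comp (B C D : Category) (G : Functor C D) (F : Functor B C) :
  Functor B D.
Proof.
  refine {| fobj := fun X => G (F X); fmap := fun X Y f => fmap G (fmap F f) |}.
  - intros; now rewrite !fmap_id.
  - intros; now rewrite !fmap_comp.
Defined.

Definition full (C : Category) (P : C -> Prop) : Category.
Proof.
  refine {| ob := {X : C | P X};
            hom := fun X Y => hom (proj1_sig X) (proj1_sig Y);
            idm := fun X => idm (proj1_sig X);
            comp := fun X Y Z g f => g ∘ f |}.
  - intros; apply comp_idl.
  - intros; apply comp_idr.
  - intros; apply comp_assoc.
Defined.

Definition restr (C D : Category) (F : Functor C D) (P : C -> Prop) :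
  Functor (full P) D.
Proof.
  refine {| fobj := fun X : full P => F (proj1_sig X);
            fmap := fun X Y f => fmap F f |}.
  - intros; apply (fmap_id F).
  - intros; apply (fmap_comp F).
Defined.

Inductive is_identity (C : Category) : forall X Y : C, hom X Y -> Prop :=
| is_identity_idm : forall X : C, is_identity (idm X).

Definition finite_category (C : Category) : Prop :=
  Finite C /\ forall X Y : C, Finite (hom X Y).

Definition terminal (C : Category) (T : C) : Prop :=
  forall X, exists f : hom X T, forall g, g = f.

Definition initial (C : Category) (I : C) : Prop :=
  forall X, exists f : hom I X, forall g, g = f.

(** ** Limits *)

Record Limit (D C : Category) (F : Functor D C) := {
  lim :> C;
  leg : forall d, hom lim (F d);
  leg_natural : forall d d' (h : hom d d'), fmap F h ∘ leg d = leg d';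
  lim_map : forall (Z : C) (c : forall d, hom Z (F d)),
    (forall d d' (h : hom d d'), fmap F h ∘ c d = c d') -> hom Z lim;
  leg_lim_map : forall Z c e d, leg d ∘ @lim_map Z c e = c d;
  lim_map_unique : forall Z (u v : hom Z lim),
    (forall d, leg d ∘ u = leg d ∘ v) -> u = v
}.
Arguments leg {_ _ _} _ _.
Arguments lim_map {_ _ _} _ {_} _ _.

Record Colimit (D C : Category) (F : Functor D C) := {
  colim :> C;
  coleg : forall d, hom (F d) colim;
  coleg_natural : forall d d' (h : hom d d'), coleg d' ∘ fmap F h = coleg d;
  colim_map : forall (Z : C) (c : forall d, hom (F d) Z),
    (forall d d' (h : hom d d'), c d' ∘ fmap F h = c d) -> hom colim Z;
  coleg_colim_map : forall Z c e d, @colim_map Z c e ∘ coleg d = c d;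
  colim_map_unique : forall Z (u v : hom colim Z),
    (forall d, u ∘ coleg d = v ∘ coleg d) -> u = v
}.

Record Product (C : Category) (I : Type) (A : I -> C) := {
  prod_ob :> C;
  proj : forall i, hom prod_ob (A i);
  pair_map : forall Z, (forall i, hom Z (A i)) -> hom Z prod_ob;
  proj_pair_map : forall Z (c : forall i, hom Z (A i)) i,
    proj i ∘ pair_map c = c i;
  pair_map_unique : forall Z (u v : hom Z prod_ob),
    (forall i, proj i ∘ u = proj i ∘ v) -> u = v
}.
Arguments proj {_ _ _} _ _.
Arguments pair_map {_ _ _} _ {_} _.

Lemma proj_pair_comp (C : Category) (I : Type) (A : I -> C) (P : Product A)
    (W Z : C) (c : forall i, hom Z (A i)) (u : hom W Z) (i : I) :
  proj P i ∘ (pair_map P c ∘ u) = c i ∘ u.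
Proof. now rewrite comp_assoc, proj_pair_map. Qed.

Definition prod_map (C : Category) (I : Type) (A B : I -> C)
    (P : Product A) (Q : Product B) (f : forall i, hom (A i) (B i)) : hom P Q :=
  pair_map Q (fun i => f i ∘ proj P i).

Record Pullback (C : Category) (A B S : C) (a : hom A S) (b : hom B S) := {
  pb_ob :> C;
  pb_fst : hom pb_ob A;
  pb_snd : hom pb_ob B;
  pb_square : a ∘ pb_fst = b ∘ pb_snd;
  pb_map : forall Z (u : hom Z A) (v : hom Z B), a ∘ u = b ∘ v -> hom Z pb_ob;
  pb_fst_map : forall Z u v e, pb_fst ∘ @pb_map Z u v e = u;
  pb_snd_map : forall Z u v e, pb_snd ∘ @pb_map Z u v e = v;
  pb_map_unique : forall Z (u v : hom Z pb_ob),
    pb_fst ∘ u = pb_fst ∘ v -> pb_snd ∘ u = pb_snd ∘ v -> u = v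
}.
Arguments pb_fst {_ _ _ _ _ _} _.
Arguments pb_snd {_ _ _ _ _ _} _.
Arguments pb_map {_ _ _ _ _ _} _ {_} _ _ _.

(** * Model categories *)

Definition is_retract (C : Category) (X Y X' Y' : C)
    (f : hom X Y) (g : hom X' Y') : Prop :=
  exists (i : hom X X') (r : hom X' X) (j : hom Y Y') (s : hom Y' Y),
    r ∘ i = idm X /\ s ∘ j = idm Y /\ g ∘ i = j ∘ f /\ f ∘ r = s ∘ g.

Definition has_lifting (C : Category) (A B X Y : C)
    (i : hom A B) (p : hom X Y) : Prop :=
  forall (u : hom A X) (v : hom B Y), p ∘ u = v ∘ i ->
    exists h : hom B X, h ∘ i = u /\ p ∘ h = v.

(** Quillen's closed model categories: only finite limits and colimits are
    required, and factorizations need not be functorial. *)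
Record ModelCategory := {
  mcat :> Category;
  weq : forall X Y : mcat, hom X Y -> Prop;
  cof : forall X Y : mcat, hom X Y -> Prop;
  fib : forall X Y : mcat, hom X Y -> Prop;
  mc_lim : forall (D : Category) (F : Functor D mcat),
    finite_category D -> inhabited (Limit F);
  mc_colim : forall (D : Category) (F : Functor D mcat),
    finite_category D -> inhabited (Colimit F);
  mc_two_three : forall X Y Z (g : hom Y Z) (f : hom X Y),
    (weq f -> weq g -> weq (g ∘ f)) /\
    (weq f -> weq (g ∘ f) -> weq g) /\
    (weq g -> weq (g ∘ f) -> weq f);
  mc_weq_retract : forall X Y X' Y' (f : hom X Y) (g : hom X' Y'),
    is_retract f g -> weq g -> weq f;
  mc_cof_retract : forall X Y X' Y' (f : hom X Y) (g : hom X' Y'),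
    is_retract f g -> cof g -> cof f;
  mc_fib_retract : forall X Y X' Y' (f : hom X Y) (g : hom X' Y'),
    is_retract f g -> fib g -> fib f;
  mc_lift_tcof : forall A B X Y (i : hom A B) (p : hom X Y),
    cof i -> weq i -> fib p -> has_lifting i p;
  mc_lift_tfib : forall A B X Y (i : hom A B) (p : hom X Y),
    cof i -> fib p -> weq p -> has_lifting i p;
  mc_factor_tcof : forall X Y (f : hom X Y),
    exists (Z : mcat) (i : hom X Z) (p : hom Z Y),
      cof i /\ weq i /\ fib p /\ p ∘ i = f;
  mc_factor_tfib : forall X Y (f : hom X Y),
    exists (Z : mcat) (i : hom X Z) (p : hom Z Y),
      cof i /\ fib p /\ weq p /\ p ∘ i = f
}.
Arguments weq {_ _ _} _.
Arguments cof {_ _ _} _.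
Arguments fib {_ _ _} _.

Definition fibrant (E : ModelCategory) (X : E) : Prop :=
  forall (T : E) (f : hom X T), terminal T -> fib f.

Definition cofibrant (E : ModelCategory) (X : E) : Prop :=
  forall (I : E) (f : hom I X), initial I -> cof f.

(** A cylinder object is a factorization of the fold map [X ⊔ X -> X] through
    an arbitrary map (given here by [i0] and [i1]) and a weak equivalence. *)
Definition left_homotopic (E : ModelCategory) (X Y : E) (f g : hom X Y) : Prop :=
  exists (C : E) (i0 i1 : hom X C) (p : hom C X) (H : hom C Y),
    weq p /\ p ∘ i0 = idm X /\ p ∘ i1 = idm X /\ H ∘ i0 = f /\ H ∘ i1 = g.

Definition right_homotopic (E : ModelCategory) (X Y : E) (f g : hom X Y) : Prop :=
  exists (P : E) (w : hom Y P) (p0 p1 : hom P Y) (H : hom X P),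
    weq w /\ p0 ∘ w = idm Y /\ p1 ∘ w = idm Y /\ p0 ∘ H = f /\ p1 ∘ H = g.

Definition homotopic (E : ModelCategory) (X Y : E) (f g : hom X Y) : Prop :=
  left_homotopic f g /\ right_homotopic f g.

Definition homotopy_class (E : ModelCategory) (X Y : E) (f : hom X Y) :
  hom X Y -> Prop := fun g => homotopic f g.

Record TCofFibFactorization (E : ModelCategory) (X Y : E) (f : hom X Y) := {
  fac_ob :> E;
  fac_tcof : hom X fac_ob;
  fac_fib : hom fac_ob Y;
  fac_cofP : cof fac_tcof;
  fac_weqP : weq fac_tcof;
  fac_fibP : fib fac_fib;
  fac_eq : fac_fib ∘ fac_tcof = f
}.
Arguments fac_tcof {_ _ _ _} _.
Arguments fac_fib {_ _ _ _} _.

(** * The homotopy category *)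

(** The localization of [E] at its weak equivalences has the objects of [E];
    its morphisms are formal composites of morphisms of [E] and formal inverses
    of weak equivalences, modulo the smallest congruence that makes [w_mor]
    functorial and [w_inv] inverse to [w_mor]. *)
Inductive word (E : ModelCategory) : E -> E -> Type :=
| w_mor : forall X Y : E, hom X Y -> word X Y
| w_inv : forall (X Y : E) (w : hom X Y), weq w -> word Y X
| w_comp : forall X Y Z : E, word Y Z -> word X Y -> word X Z.

Inductive word_eq (E : ModelCategory) :
    forall X Y : E, word X Y -> word X Y -> Prop :=
| we_refl : forall (X Y : E) (a : word X Y), word_eq a a
| we_sym : forall (X Y : E) (a b : word X Y), word_eq a b -> word_eq b a
| we_trans : forall (X Y : E) (a b c : word X Y),
    word_eq a b -> word_eq b c -> word_eq a c
| we_comp : forall (X Y Z : E) (a a' : word Y Z) (b b' : word X Y),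
    word_eq a a' -> word_eq b b' -> word_eq (w_comp a b) (w_comp a' b')
| we_idl : forall (X Y : E) (a : word X Y), word_eq (w_comp (w_mor (idm Y)) a) a
| we_idr : forall (X Y : E) (a : word X Y), word_eq (w_comp a (w_mor (idm X))) a
| we_assoc : forall (W X Y Z : E) (a : word Y Z) (b : word X Y) (c : word W X),
    word_eq (w_comp a (w_comp b c)) (w_comp (w_comp a b) c)
| we_mor_comp : forall (X Y Z : E) (g : hom Y Z) (f : hom X Y),
    word_eq (w_comp (w_mor g) (w_mor f)) (w_mor (g ∘ f))
| we_invl : forall (X Y : E) (w : hom X Y) (h : weq w),
    word_eq (w_comp (w_inv h) (w_mor w)) (w_mor (idm X))
| we_invr : forall (X Y : E) (w : hom X Y) (h : weq w),
    word_eq (w_comp (w_mor w) (w_inv h)) (w_mor (idm Y)).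

Definition ho_hom (E : ModelCategory) (X Y : E) : Type :=
  {C : word X Y -> Prop | exists a, C = word_eq a}.

Definition ho_class (E : ModelCategory) (X Y : E) (a : word X Y) : ho_hom X Y :=
  exist _ (word_eq a) (ex_intro _ a eq_refl).

Definition ho_repr (E : ModelCategory) (X Y : E) (c : ho_hom X Y) : word X Y :=
  proj1_sig (constructive_indefinite_description _ (proj2_sig c)).

Lemma ho_class_eq (E : ModelCategory) (X Y : E) (a b : word X Y) :
  ho_class a = ho_class b <-> word_eq a b.
Proof.
  split.
  - intro e. assert (e' : word_eq a = word_eq b) by exact (f_equal (@proj1_sig _ _) e).
    rewrite e'. apply we_refl.
  - intro h. apply eq_sig_hprop; [intros; apply proof_irrelevance|]. cbn.
    extensionality c. apply propositional_extensionality. split; intro hc.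
    + exact (we_trans (we_sym h) hc).
    + exact (we_trans h hc).
Qed.

Lemma ho_class_repr (E : ModelCategory) (X Y : E) (c : ho_hom X Y) :
  ho_class (ho_repr c) = c.
Proof.
  apply eq_sig_hprop; [intros; apply proof_irrelevance|]. cbn. unfold ho_repr.
  destruct (constructive_indefinite_description _ (proj2_sig c)) as [a ha].
  now symmetry.
Qed.

Lemma ho_repr_class (E : ModelCategory) (X Y : E) (a : word X Y) :
  word_eq (ho_repr (ho_class a)) a.
Proof. apply ho_class_eq, ho_class_repr. Qed.

Definition Ho (E : ModelCategory) : Category.
Proof.
  refine {| ob := E; hom := @ho_hom E;
            idm := fun X => ho_class (w_mor (idm X));
            comp := fun X Y Z g f => ho_class (w_comp (ho_repr g) (ho_repr f)) |}.
  - intros X Y f. rewrite <- (ho_class_repr f) at 2. apply ho_class_eq.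
    eapply we_trans; [apply we_comp; [apply ho_repr_class | apply we_refl]|].
    apply we_idl.
  - intros X Y f. rewrite <- (ho_class_repr f) at 2. apply ho_class_eq.
    eapply we_trans; [apply we_comp; [apply we_refl | apply ho_repr_class]|].
    apply we_idr.
  - intros W X Y Z h g f. apply ho_class_eq.
    eapply we_trans; [apply we_comp; [apply we_refl | apply ho_repr_class]|].
    eapply we_trans; [apply we_assoc|].
    apply we_comp; [apply we_sym, ho_repr_class | apply we_refl].
Defined.

Definition to_ho (E : ModelCategory) : Functor E (Ho E).
Proof.
  refine {| fobj := fun X : E => (X : Ho E);
            fmap := fun X Y (f : hom X Y) => (ho_class (w_mor f) : @hom (Ho E) X Y) |}.
  - reflexivity.
  - intros X Y Z g f. apply ho_class_eq. apply we_sym.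
    eapply we_trans; [apply we_comp; apply ho_repr_class|]. apply we_mor_comp.
Defined.
Arguments to_ho {_}.

(** As [to_ho] is the identity on objects, a functor lifting [F] has the object
    function of [F]; it is determined by its action on morphisms. *)
Record Lift (E : ModelCategory) (D : Category) (F : Functor D (Ho E)) := {
  lmap : forall s t : D, hom s t -> @hom E (F s) (F t);
  lmap_id : forall s : D, lmap (idm s) = idm (F s : E);
  lmap_comp : forall (s t u : D) (g : hom t u) (f : hom s t),
    lmap (g ∘ f) = lmap g ∘ lmap f;
  lmap_lifts : forall (s t : D) (f : hom s t), fmap to_ho (lmap f) = fmap F f
}.
Arguments lmap {_ _ _} _ {_ _} _.

Definition lift_functor (E : ModelCategory) (D : Category)
    (F : Functor D (Ho E)) (Y : Lift F) : Functor D E :=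
  {| fobj := fun s => (F s : E); fmap := fun s t f => lmap Y f;
     fmap_id := lmap_id Y; fmap_comp := lmap_comp Y |}.
Coercion lift_functor : Lift >-> Functor.

Lemma lift_functor_comp (E : ModelCategory) (D : Category)
    (F : Functor D (Ho E)) (Y : Lift F) : functor_comp to_ho Y = F.
Proof.
  destruct F as [F0 F1 Fid Fc], Y as [Y1 Yid Yc Yl]; unfold functor_comp; cbn in *.
  assert (e : (fun X Y f => ho_class (w_mor (Y1 X Y f))) = F1).
  { extensionality s; extensionality t; extensionality f; apply Yl. }
  subst F1. f_equal; apply proof_irrelevance.
Qed.

(** The restrictions of [F] to two full subcategories have lifts which agree on
    the full subcategory of their common objects. *)
Definition agree (E : ModelCategory) (C : Category) (F : Functor C (Ho E))
    (P Q : C -> Prop) (Y : Lift (restr F P)) (Y' : Lift (restr F Q)) : Prop :=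
  forall (s t : C) (ps : P s) (pt : P t) (qs : Q s) (qt : Q t) (f : hom s t),
    @lmap _ _ _ Y (exist P s ps) (exist P t pt) f =
    @lmap _ _ _ Y' (exist Q s qs) (exist Q t qt) f.

(** * Weak lattices *)

(** Since non-identity morphisms strictly decrease degree, the Reedy structure
    has only identities as degree-raising morphisms. *)
Record WeakLattice := {
  wl_cat :> Category;
  deg : wl_cat -> nat;
  wl_inhabited : inhabited wl_cat;
  wl_connected : forall s t : wl_cat,
    clos_refl_sym_trans wl_cat (fun a b => inhabited (hom a b)) s t;
  wl_hom_finite : forall s t : wl_cat, Finite (hom s t);
  wl_deg_finite : forall d : nat, Finite {s : wl_cat | deg s = d};
  wl_lower : forall (s t : wl_cat) (f : hom s t), is_identity f \/ deg t < deg s;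
  wl_zero : forall s : wl_cat, exists t, inhabited (hom s t) /\ deg t = 0
}.
Arguments deg {_} _.

(** Objects of [J^x], of [J^x_k] and of [∂J^x_k]. *)
Definition inJ (J : WeakLattice) (x t : J) : Prop := inhabited (hom x t).

Definition inJk (J : WeakLattice) (x : J) (k : nat) (t : J) : Prop :=
  inJ x t /\ (t = x \/ deg t <= k).

Definition indJk (J : WeakLattice) (x : J) (k : nat) (t : J) : Prop :=
  inJk x k t /\ t <> x.

(** The index category of the matching object [M^s_(j-1)]: morphisms from [s] to
    objects of degree less than [j], and commuting triangles under [s]. *)
Record under_ob (J : WeakLattice) (s : J) (j : nat) := Under {
  u_tgt :> J;
  u_mor : hom s u_tgt;
  u_deg : deg u_tgt < j
}.

Definition under (J : WeakLattice) (s : J) (j : nat) : Category.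
Proof.
  refine {| ob := under_ob s j;
            hom := fun u v => {h : hom u v | h ∘ u_mor u = u_mor v};
            idm := fun u => exist _ (idm (u_tgt u)) (comp_idl (u_mor u));
            comp := fun u v w h g => exist _ (proj1_sig h ∘ proj1_sig g) _ |}.
  Unshelve.
  - intros u v [f hf]; apply eq_sig_hprop; [intros; apply proof_irrelevance|].
    apply comp_idl.
  - intros u v [f hf]; apply eq_sig_hprop; [intros; apply proof_irrelevance|].
    apply comp_idr.
  - intros; apply eq_sig_hprop; [intros; apply proof_irrelevance|].
    apply comp_assoc.
  - destruct g as [g hg], h as [h hh]; cbn.
    now rewrite <- comp_assoc, hg.
Defined.

(** The index set of [∏_(|s|=k) ∏_(J(x,s))]. *)
Record level_ob (J : WeakLattice) (x : J) (k : nat) := Level {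
  l_tgt :> J;
  l_mor : hom x l_tgt;
  l_deg : deg l_tgt = k
}.

Section Lattice.
Variables (J : WeakLattice) (x : J) (k : nat).

Lemma deg_le (s t : J) (f : hom s t) : deg t <= deg s.
Proof. destruct (wl_lower f) as [[]|]; lia. Qed.

Lemma inJk_self : inJk x k x.
Proof. split; [exact (inhabits (idm x)) | now left]. Qed.

Lemma inJk_under (u : under_ob x k) : inJk x (k - 1) u.
Proof.
  split; [exact (inhabits (u_mor u)) | right; pose proof (u_deg u); lia].
Qed.

Lemma indJk_level (h : k < deg x) (g : level_ob x k) : indJk x k g.
Proof.
  pose proof (l_deg g). repeat split.
  - exact (l_mor g).
  - right; lia.
  - intro e; rewrite e in *; lia.
Qed.

Lemma indJk_closed (s t : J) (f : hom s t) : indJk x k s -> indJk x k t.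
Proof.
  intros [[[g] hs] ns]. pose proof (deg_le f). repeat split.
  - exact (f ∘ g).
  - right; destruct hs; [contradiction | lia].
  - intro e; subst t. destruct (wl_lower g) as [i|]; [|lia]. now destruct i.
Qed.

Definition under_comp (s : J) (g : hom x s) (j : nat) (f : under_ob s j) :
    under_ob x j :=
  {| u_tgt := f; u_mor := u_mor f ∘ g; u_deg := u_deg f |}.

Definition in_boundary (s : full (indJk x k)) (j : nat)
    (u : under_ob (proj1_sig s) j) : full (indJk x k) :=
  exist _ (u_tgt u) (indJk_closed (u_mor u) (proj2_sig s)).

(** ** Matching objects *)

Variables (E : ModelCategory) (Y : Functor (full (indJk x k)) E).

Definition matching_diagram (s : full (indJk x k)) (j : nat) :
  Functor (under (proj1_sig s) j) E.
Proof.
  refine {| fobj := fun u : under (proj1_sig s) j => Y (in_boundary u);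
            fmap := fun u v h => @fmap _ _ Y (in_boundary u) (in_boundary v)
                                   (proj1_sig h) |}.
  - intro u. exact (fmap_id Y (in_boundary u)).
  - intros u v w h g.
    exact (@fmap_comp _ _ Y (in_boundary u) (in_boundary v) (in_boundary w) _ _).
Defined.

Definition matching_legs (s : full (indJk x k)) (j : nat)
    (u : under (proj1_sig s) j) : hom (Y s) (matching_diagram s j u) :=
  @fmap _ _ Y s (in_boundary u) (u_mor u).

Lemma matching_legs_natural (s : full (indJk x k)) (j : nat)
    (u v : under (proj1_sig s) j) (h : hom u v) :
  fmap (matching_diagram s j) h ∘ matching_legs u = matching_legs v.
Proof.
  unfold matching_legs; cbn.
  rewrite <- (@fmap_comp _ _ Y s (in_boundary u) (in_boundary v)).
  f_equal. exact (proj2_sig h).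
Qed.

Definition matching_map (s : full (indJk x k)) (j : nat)
    (M : Limit (matching_diagram s j)) : hom (Y s) M :=
  lim_map M (@matching_legs s j) (@matching_legs_natural s j).

(** If [deg s = 0] the diagram is empty and [M] is terminal, so that the
    condition says that [Y s] is fibrant. *)
Definition reedy_fibrant : Prop :=
  forall (s : full (indJk x k))
    (M : Limit (matching_diagram s (deg (proj1_sig s)))),
    fib (matching_map M).

Definition forget (s : full (indJk x k)) (j : nat)
    (M : Limit (matching_diagram s j))
    (P : Product (fun u : under_ob (proj1_sig s) j => Y (in_boundary u))) :
    hom M P :=
  pair_map P (leg M).

End Lattice.

(** * The total higher homotopy operation *)

Section Operation.
Variables (E : ModelCategory) (J : WeakLattice) (Yt : Functor J (Ho E)).
Variables (x : J) (k : nat) (hk : k < deg x).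
Variable Yk : Lift (restr Yt (indJk x k)).
Variable Yx : Lift (restr Yt (inJk x (k - 1))).
Hypothesis hY : agree Yk Yx.

Local Notation Y t := (fobj Yt t : ob (mcat E)).

Definition level_in (g : level_ob x k) : full (indJk x k) :=
  exist _ (l_tgt g) (indJk_level hk g).

(** [Y^x_(k-1)(f)] for [f : x -> t] with [|t| < k]. *)
Definition Yx_at (u : under_ob x k) : hom (Y x) (Y u) :=
  @lmap _ _ _ Yx (exist _ x (inJk_self x (k - 1))) (exist _ (u_tgt u) (inJk_under u))
    (u_mor u).

(** Iterated products are flattened, except that the target of [Psi] is a product
    over [g : x -> s] of products over [f : s -> v]. All of these limits exist,
    since [J] has finitely many morphisms from a given object. *)
Record Choices := {
  ch_below : Product (fun u : under_ob x k => Y u);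
  ch_level : Product (fun g : level_ob x k => Y g);
  ch_match : forall s : full (indJk x k), Limit (matching_diagram Yk s k);
  ch_inner : forall s : full (indJk x k),
    Product (fun u : under_ob (proj1_sig s) k => Y u);
  ch_outer : Product (fun g : level_ob x k => ch_inner (level_in g) : E);
  ch_prodM : Product (fun g : level_ob x k => ch_match (level_in g) : E)
}.
Variable c : Choices.

Definition sigma_below : hom (Y x) (ch_below c) :=
  pair_map (ch_below c) Yx_at.

Definition sigma_at (s : full (indJk x k)) :
    hom (Y (proj1_sig s)) (ch_inner c s) :=
  pair_map (ch_inner c s) (fun u => @lmap _ _ _ Yk s (in_boundary u) (u_mor u)).

Definition prod_sigma : hom (ch_level c) (ch_outer c) :=
  prod_map (ch_level c) (ch_outer c) (fun g => sigma_at (level_in g)).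

Definition Psi : hom (ch_below c) (ch_outer c) :=
  pair_map (ch_outer c) (fun g =>
    pair_map (ch_inner c (level_in g)) (fun f : under_ob g k =>
      proj (ch_below c) (under_comp (l_mor g) f))).

Definition prod_forget : hom (ch_prodM c) (ch_outer c) :=
  prod_map (ch_prodM c) (ch_outer c) (fun g =>
    forget (ch_match c (level_in g)) (ch_inner c (level_in g))).

Lemma rho_natural (g : level_ob x k) (u v : under (l_tgt g) k) (h : hom u v) :
  fmap (matching_diagram Yk (level_in g) k) h ∘ Yx_at (under_comp (l_mor g) u) =
  Yx_at (under_comp (l_mor g) v).
Proof.
  cbn. unfold in_boundary.
  rewrite (hY _ _ (inJk_under (under_comp (l_mor g) u))
                  (inJk_under (under_comp (l_mor g) v))).
  pose proof (@lmap_comp _ _ _ Yx (exist _ x (inJk_self x (k - 1)))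
    (exist _ _ (inJk_under (under_comp (l_mor g) u)))
    (exist _ _ (inJk_under (under_comp (l_mor g) v)))
    (proj1_sig h) (u_mor (under_comp (l_mor g) u))) as e.
  etransitivity; [symmetry; exact e|].
  unfold Yx_at. f_equal. cbn. rewrite comp_assoc. f_equal. exact (proj2_sig h).
Qed.

Definition rho (g : level_ob x k) : hom (Y x) (ch_match c (level_in g)) :=
  lim_map (ch_match c (level_in g)) (fun u => Yx_at (under_comp (l_mor g) u))
    (@rho_natural g).

Lemma eta_square :
  Psi ∘ sigma_below = prod_forget ∘ pair_map (ch_prodM c) rho.
Proof.
  unfold Psi, sigma_below, prod_forget, prod_map, forget.
  apply pair_map_unique; intro g.
  etransitivity; [apply (@proj_pair_comp _ _ _ (ch_outer c))|].
  etransitivity; [|symmetry; apply (@proj_pair_comp _ _ _ (ch_outer c))].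
  apply pair_map_unique; intro u.
  etransitivity; [apply (@proj_pair_comp _ _ _ (ch_inner c (level_in g)))|].
  etransitivity; 
    [exact (@proj_pair_map _ _ _ (ch_below c) _ Yx_at (under_comp (l_mor g) u))|].
  rewrite <- comp_assoc.
  etransitivity;
    [|symmetry; apply (@proj_pair_comp _ _ _ (ch_inner c (level_in g)))].
  etransitivity;
    [|symmetry; apply (f_equal (comp _)), (@proj_pair_map _ _ _ (ch_prodM c))].
  symmetry.
  exact (@leg_lim_map _ _ _ (ch_match c (level_in g)) _ _ (@rho_natural g) u).
Qed.

Definition eta (Q : Pullback Psi prod_forget) : hom (Y x) Q :=
  pb_map Q sigma_below (pair_map (ch_prodM c) rho) eta_square.

Variable F1 : TCofFibFactorization Psi.

Lemma gamma_square (Q : Pullback Psi prod_forget) :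
  fac_fib F1 ∘ (fac_tcof F1 ∘ pb_fst Q) = prod_forget ∘ pb_snd Q.
Proof. rewrite comp_assoc, (fac_eq F1). apply pb_square. Qed.

Variable F2 : Pullback (fac_fib F1) prod_forget.

Definition gamma (Q : Pullback Psi prod_forget) : hom Q F2 :=
  pb_map F2 (fac_tcof F1 ∘ pb_fst Q) (pb_snd Q) (gamma_square Q).

Variable sigma_k : hom (Y x) (ch_level c).

Definition represents : Prop :=
  forall g : level_ob x k,
    fmap to_ho (proj (ch_level c) g ∘ sigma_k) = fmap Yt (l_mor g).

(** A set of homotopy classes, each of them a predicate on morphisms. *)
Definition total_operation (C : hom (Y x) F2 -> Prop) : Prop :=
  exists theta : hom (Y x) F2,
    homotopic (pb_fst F2 ∘ theta) (fac_tcof F1 ∘ sigma_below) /\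
    fac_fib F1 ∘ pb_fst F2 ∘ theta = prod_sigma ∘ sigma_k /\
    C = homotopy_class theta.

Definition vanishes (Q : Pullback Psi prod_forget) : Prop :=
  total_operation (homotopy_class (gamma Q ∘ eta Q)).

End Operation.

(* Main.v *)
Require Import Defs.
From Stdlib Require Import Arith Lia FinFun List.
From Stdlib Require Import Classical ClassicalEpsilon FunctionalExtensionality
  PropExtensionality.
Import ListNotations.

(** An extension of [Yk] and [Yx] amounts to maps [z_g : Y x -> Y s], one for each
    [g : x -> s] with [|s| = k], which represent the prescribed classes and satisfy
    [m^s ∘ z_g = rho g]. The second component of [theta : Y x -> F2] is
    [∏ m^s ∘ sigma_k], as [∏ forget] is monic, and that of [gamma ∘ eta] is
    [(rho g)_g].
    - If [theta ~ gamma ∘ eta], then [m^s ∘ sigma_k(g) ~ rho g], and lifting this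
      homotopy along the fibration [m^s] deforms [sigma_k(g)] to some [z_g].
    - Conversely, [z_g] and [sigma_k(g)] have the same class in the homotopy
      category, hence are homotopic. Lifting [∏ m^s] of this homotopy along the
      fibration [F2 -> ∏ M^s], from [gamma ∘ eta] on, gives [theta]. *)

Set Implicit Arguments.
Unset Strict Implicit.

(** * Finite limits and colimits *)

Section FiniteLimits.
Variable E : ModelCategory.

(** Excluded middle decides whether the type is inhabited, and proof irrelevance leaves it at most
    one element. *)
Lemma finite_eq (I : Type) (i j : I) : Finite (i = j).
Proof.
  destruct (classic (i = j)) as [e|n].
  - exists [e]. intro e'. left. apply proof_irrelevance.
  - exists []. intro e. contradiction.
Qed.

Definition discrete (I : Type) : Category.
Proof.
  refine {| ob := I; hom := fun i j => i = j; idm := fun i => eq_refl;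
            comp := fun i j l g f => eq_trans f g |};
    intros; apply proof_irrelevance.
Defined.

Definition discrete_functor (I : Type) (A : I -> E) : Functor (discrete I) E.
Proof.
  unshelve refine {| fobj := A : discrete I -> E;
     fmap := fun i j (e : i = j) => match e with eq_refl => idm (A i) end |}.
  - reflexivity.
  - intros i j l g f. cbn in *. destruct g, f. symmetry; apply comp_idl.
Defined.

Lemma finite_discrete (I : Type) : Finite I -> finite_category (discrete I).
Proof. intro h. split; [exact h | intros; apply finite_eq]. Qed.

(** A product is a limit over the discrete category, whose naturality conditions reduce to unit
    laws. *)
Lemma finite_product (I : Type) (A : I -> E) : Finite I ->
  exists (P : E) (pr : forall i, hom P (A i)),
    (forall Z (u : forall i, hom Z (A i)), exists h, forall i, pr i ∘ h = u i) /\
    (forall Z (u v : hom Z P), (forall i, pr i ∘ u = pr i ∘ v) -> u = v).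
Proof.
  intro h. destruct (mc_lim (discrete_functor A) (finite_discrete h)) as [L].
  exists L, (leg L). split.
  - intros Z u. unshelve eexists (lim_map L u _).
    + intros i j e. cbn in *. destruct e. apply comp_idl.
    + intro i. exact (@leg_lim_map _ _ _ L Z u _ i).
  - apply lim_map_unique.
Qed.

Lemma finite_coproduct (I : Type) (A : I -> E) : Finite I ->
  exists (P : E) (inj : forall i, hom (A i) P),
    (forall Z (u : forall i, hom (A i) Z), exists h, forall i, h ∘ inj i = u i) /\
    (forall Z (u v : hom P Z), (forall i, u ∘ inj i = v ∘ inj i) -> u = v).
Proof.
  intro h. destruct (mc_colim (discrete_functor A) (finite_discrete h)) as [L].
  exists L, (coleg L). split.
  - intros Z u. unshelve eexists (colim_map L (Z := Z) (c := u) _).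
    + intros i j e. cbn in *. destruct e. apply comp_idr.
    + intro i. exact (@coleg_colim_map _ _ _ L Z u _ i).
  - apply colim_map_unique.
Qed.

Lemma terminal_exists : exists T : E, terminal T.
Proof.
  destruct (@finite_product Empty_set (fun i => match i with end)) as (T & pr & ex & un).
  - exists []. intros [].
  - exists T. intro X. destruct (ex X (fun i => match i with end)) as [h _].
    exists h. intro g. apply un. intros [].
Qed.

Lemma initial_exists : exists T : E, initial T.
Proof.
  destruct (@finite_coproduct Empty_set (fun i => match i with end)) as (T & pr & ex & un).
  - exists []. intros [].
  - exists T. intro X. destruct (ex X (fun i => match i with end)) as [h _].
    exists h. intro g. apply un. intros [].
Qed.

Lemma finite_bool : Finite bool.
Proof. exists [true; false]. intros []; cbn; auto. Qed.

(** The walking span has apex [None] and feet [Some b]. *)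
Definition span_hom (a b : option bool) : Type :=
  match a, b with
  | None, None | None, Some _ | Some true, Some true | Some false, Some false => unit
  | _, _ => Empty_set
  end.

Lemma span_hom_unique a b (f g : span_hom a b) : f = g.
Proof. destruct a as [[]|], b as [[]|]; destruct f, g; reflexivity. Qed.

Definition span : Category.
Proof.
  unshelve refine {| ob := option bool; hom := span_hom |}.
  - intros [[]|]; exact tt.
  - intros [[]|] [[]|] [[]|]; cbn; intros [] []; exact tt.
  - intros; apply span_hom_unique.
  - intros; apply span_hom_unique.
  - intros; apply span_hom_unique.
Defined.

Definition span_functor (X B C : E) (f : hom X B) (g : hom X C) : Functor span E.
Proof.
  unshelve refine
    {| fobj := fun a : span =>
         match a with None => X | Some true => B | Some false => C end |}.
  - intros [[]|] [[]|]; cbn; intros []; [exact (idm _) .. | exact f | exact g | exact (idm _)].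
  - intros [[]|]; reflexivity.
  - intros [[]|] [[]|] [[]|]; cbn; intros [] [];
      symmetry; first [apply comp_idl | apply comp_idr].
Defined.

Lemma finite_span : finite_category span.
Proof.
  split.
  - exists [None; Some true; Some false]. intros [[]|]; cbn; auto.
  - intros [[]|] [[]|]; cbn; first [exists [tt]; intros []; now left | exists []; intros []].
Qed.

Lemma pushout_exists (X B C : E) (f : hom X B) (g : hom X C) :
  exists (P : E) (a : hom B P) (b : hom C P),
    a ∘ f = b ∘ g /\
    (forall Z (u : hom B Z) (v : hom C Z), u ∘ f = v ∘ g ->
       exists h, h ∘ a = u /\ h ∘ b = v) /\
    (forall Z (u v : hom P Z), u ∘ a = v ∘ a -> u ∘ b = v ∘ b -> u = v).
Proof.
  destruct (mc_colim (span_functor f g) finite_span) as [L].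
  exists L, (coleg L (Some true : span)), (coleg L (Some false : span)).
  pose proof (coleg_natural L (d := None : span) (d' := Some true : span) tt) as e1.
  pose proof (coleg_natural L (d := None : span) (d' := Some false : span) tt) as e2.
  cbn in e1, e2. split; [congruence | split].
  - intros Z u v e.
    unshelve epose (m := colim_map L (Z := Z) (c := fun d : span =>
      match d return hom (span_functor f g d) Z with
      | None => u ∘ f | Some true => u | Some false => v end) _).
    + intros [[]|] [[]|]; cbn; intros []; try apply comp_idr; auto.
    + exists m. split.
      * exact (coleg_colim_map L _ (Some true : span)).
      * exact (coleg_colim_map L _ (Some false : span)).
  - intros Z u v ea eb. apply (@colim_map_unique _ _ _ L).
    intros [[]|]; [exact ea | exact eb |].
    (* The leg at the apex factors through the foot [B], so agreement there follows from [ea]. *)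
    rewrite <- e1, !comp_assoc. congruence.
Qed.

End FiniteLimits.

(** * Homotopies *)

Section Homotopy.
Variable E : ModelCategory.

(** Any weak equivalence [i] out of [X] gives this by cancelling [i] in [i ∘ idm X = i]; factoring
    [idm X] supplies one. *)
Lemma weq_id (X : E) : weq (idm X).
Proof.
  destruct (mc_factor_tcof (idm X)) as (Z & i & p & _ & wi & _).
  apply (proj2 (proj2 (mc_two_three i (idm X)))); [exact wi|].
  now rewrite comp_idr.
Qed.

Lemma weq_comp (X Y Z : E) (g : hom Y Z) (f : hom X Y) :
  weq f -> weq g -> weq (g ∘ f).
Proof. apply mc_two_three. Qed.

Lemma weq_cancel_r (X Y Z : E) (g : hom Y Z) (f : hom X Y) :
  weq f -> weq (g ∘ f) -> weq g.
Proof. apply mc_two_three. Qed.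

Lemma weq_cancel_l (X Y Z : E) (g : hom Y Z) (f : hom X Y) :
  weq g -> weq (g ∘ f) -> weq f.
Proof. apply mc_two_three. Qed.

Lemma weq_section (X Y : E) (i : hom X Y) (p : hom Y X) :
  weq p -> p ∘ i = idm X -> weq i.
Proof. intros wp e. apply (weq_cancel_l wp). rewrite e. apply weq_id. Qed.

(** * The retract argument and recognition of classes of maps by lifting *)

Lemma retract_left (A B Z : E) (i : hom A B) (j : hom A Z) (p : hom Z B) :
  has_lifting i p -> p ∘ j = i -> is_retract i j.
Proof.
  intros l e. destruct (l j (idm B)) as (h & h1 & h2).
  { now rewrite comp_idl. }
  exists (idm A), (idm A), h, p. rewrite !comp_idr. auto.
Qed.

Lemma retract_right (A B Z : E) (p : hom A B) (j : hom A Z) (q : hom Z B) :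
  has_lifting j p -> q ∘ j = p -> is_retract p q.
Proof.
  intros l e. destruct (l (idm A) q) as (h & h1 & h2).
  { now rewrite comp_idr. }
  exists j, h, (idm B), (idm B). rewrite !comp_idl. auto.
Qed.

Lemma cof_of_lifting (A B : E) (i : hom A B) :
  (forall X Y (p : hom X Y), fib p -> weq p -> has_lifting i p) -> cof i.
Proof.
  intro l. destruct (mc_factor_tfib i) as (Z & j & p & cj & fp & wp & e).
  apply (mc_cof_retract (retract_left (l _ _ _ fp wp) e) cj).
Qed.

Lemma tcof_of_lifting (A B : E) (i : hom A B) :
  (forall X Y (p : hom X Y), fib p -> has_lifting i p) -> cof i /\ weq i.
Proof.
  intro l. destruct (mc_factor_tcof i) as (Z & j & p & cj & wj & fp & e).
  pose proof (retract_left (l _ _ _ fp) e) as r. split.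
  - exact (mc_cof_retract r cj).
  - exact (mc_weq_retract r wj).
Qed.

Lemma fib_of_lifting (A B : E) (p : hom A B) :
  (forall X Y (i : hom X Y), cof i -> weq i -> has_lifting i p) -> fib p.
Proof.
  intro l. destruct (mc_factor_tcof p) as (Z & j & q & cj & wj & fq & e).
  exact (mc_fib_retract (retract_right (l _ _ _ cj wj) e) fq).
Qed.

(** The extension property of a fibrant object, in a form that mentions no terminal object. *)
Definition tcof_injective (W : E) : Prop :=
  forall (A B : E) (i : hom A B), cof i -> weq i ->
  forall u : hom A W, exists v, v ∘ i = u.

Definition tfib_projective (X : E) : Prop :=
  forall (A B : E) (p : hom A B), fib p -> weq p ->
  forall v : hom X B, exists u, p ∘ u = v.

Lemma injective_over_terminal (W T : E) (f : hom W T) :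
  terminal T -> fib f -> tcof_injective W.
Proof.
  intros t ff A B i ci wi u. destruct (t B) as [b _].
  destruct (mc_lift_tcof ci wi ff (u := u) (v := b)) as (h & hi & _).
  - destruct (t A) as [a ua]. now rewrite (ua (f ∘ u)), (ua (b ∘ i)).
  - now exists h.
Qed.

Lemma fibrant_injective (W : E) : fibrant W -> tcof_injective W.
Proof.
  intro fW. destruct (terminal_exists E) as [T t]. destruct (t W) as [f _].
  exact (injective_over_terminal t (fW T f t)).
Qed.

Lemma cofibrant_projective (X : E) : cofibrant X -> tfib_projective X.
Proof.
  intros cX A B p fp wp v. destruct (initial_exists E) as [I t].
  destruct (t X) as [f _]. destruct (t A) as [a _].
  destruct (mc_lift_tfib (cX I f t) fp wp (u := a) (v := v)) as (h & _ & hv).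
  - destruct (t B) as [b ub]. now rewrite (ub (p ∘ a)), (ub (v ∘ f)).
  - now exists h.
Qed.

Lemma fibrant_replacement (W : E) :
  exists (R : E) (r : hom W R), tcof_injective R /\ cof r /\ weq r.
Proof.
  destruct (terminal_exists E) as [T t]. destruct (t W) as [f _].
  destruct (mc_factor_tcof f) as (R & r & p & cr & wr & fp & _).
  exists R, r. split; [exact (injective_over_terminal t fp) | auto].
Qed.

(** The lifting property states that [X ⊔ X -> cyl] is a cofibration. *)
Record GoodCylinder (X : E) := {
  cyl :> E;
  cyl_in : bool -> hom X cyl;
  cyl_pr : hom cyl X;
  cyl_weq : weq cyl_pr;
  cyl_pr_in : forall b, cyl_pr ∘ cyl_in b = idm X;
  cyl_lift : forall (A B : E) (q : hom A B), fib q -> weq q ->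
    forall (u : bool -> hom X A) (v : hom cyl B),
    (forall b, q ∘ u b = v ∘ cyl_in b) ->
    exists h, (forall b, h ∘ cyl_in b = u b) /\ q ∘ h = v
}.

Arguments cyl_lift {_} _ {_ _ _} _ _ {_ _} _.

(** The lifting property states that [path -> W × W] is a fibration. *)
Record GoodPath (W : E) := {
  path :> E;
  path_const : hom W path;
  path_end : bool -> hom path W;
  path_weq : weq path_const;
  path_end_const : forall b, path_end b ∘ path_const = idm W;
  path_lift : forall (A B : E) (i : hom A B), cof i -> weq i ->
    forall (h : hom A path) (v : bool -> hom B W),
    (forall b, path_end b ∘ h = v b ∘ i) ->
    exists l, l ∘ i = h /\ (forall b, path_end b ∘ l = v b)
}.

Arguments path_lift {_} _ {_ _ _} _ _ {_ _} _.

(** * Left and right homotopies through good cylinders and good path objects *)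

Definition left_via (X W : E) (C : GoodCylinder X) (f g : hom X W) : Prop :=
  exists H : hom C W, H ∘ cyl_in C true = f /\ H ∘ cyl_in C false = g.

Definition right_via (X W : E) (P : GoodPath W) (f g : hom X W) : Prop :=
  exists H : hom X P, path_end P true ∘ H = f /\ path_end P false ∘ H = g.

Lemma left_homotopic_refl (X W : E) (f : hom X W) : left_homotopic f f.
Proof.
  exists X, (idm X), (idm X), (idm X), f. rewrite !comp_idr.
  repeat split. apply weq_id.
Qed.

Lemma right_homotopic_refl (X W : E) (f : hom X W) : right_homotopic f f.
Proof.
  exists W, (idm W), (idm W), (idm W), f. rewrite !comp_idl.
  repeat split. apply weq_id.
Qed.

Lemma left_via_homotopic (X W : E) (C : GoodCylinder X) (f g : hom X W) :
  left_via C f g -> left_homotopic f g.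
Proof.
  intros (H & e1 & e2). exists C, (cyl_in C true), (cyl_in C false), (cyl_pr C), H.
  repeat split; auto using cyl_weq, cyl_pr_in.
Qed.

Lemma right_via_homotopic (X W : E) (P : GoodPath W) (f g : hom X W) :
  right_via P f g -> right_homotopic f g.
Proof.
  intros (H & e1 & e2).
  exists P, (path_const P), (path_end P true), (path_end P false), H.
  repeat split; auto using path_weq, path_end_const.
Qed.

(** Factor [X ⊔ X -> C] as a cofibration followed by a trivial fibration [q]. The middle object is a
    good cylinder, and the homotopy is pulled back along [q]. *)
Lemma left_homotopic_via (X W : E) (f g : hom X W) :
  left_homotopic f g -> exists C : GoodCylinder X, left_via C f g.
Proof.
  intros (C & i0 & i1 & p & H & wp & e0 & e1 & h0 & h1).
  destruct (finite_coproduct (fun _ : bool => X) finite_bool) as (S & inj & ex & un).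
  destruct (ex C (fun b => if b then i0 else i1)) as [i ei].
  destruct (mc_factor_tfib i) as (C' & j & q & cj & fq & wq & e).
  assert (qj : forall b, q ∘ (j ∘ inj b) = if b then i0 else i1).
  { intro b. now rewrite comp_assoc, e, ei. }
  unshelve eexists {| cyl := C'; cyl_in := fun b => j ∘ inj b; cyl_pr := p ∘ q |}.
  - now apply weq_comp.
  - intros b. rewrite <- comp_assoc, qj. now destruct b.
  - intros A B q' fq' wq' u v euv. destruct (ex A u) as [u' eu'].
    destruct (mc_lift_tfib cj fq' wq' (u := u') (v := v)) as (h & hj & qh).
    { apply un. intro b. now rewrite <- !comp_assoc, eu'. }
    exists h. split; [|exact qh].
    intro b. rewrite comp_assoc, hj. apply eu'.
  - exists (H ∘ q). cbn. rewrite <- !(comp_assoc H), !qj. auto.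
Qed.

(** Dually, [P -> W × W] is factored as a trivial cofibration followed by a fibration. *)
Lemma right_homotopic_via (X W : E) (f g : hom X W) :
  right_homotopic f g -> exists P : GoodPath W, right_via P f g.
Proof.
  intros (P & w & p0 & p1 & H & ww & e0 & e1 & h0 & h1).
  destruct (finite_product (fun _ : bool => W) finite_bool) as (S & pr & ex & un).
  destruct (ex P (fun b => if b then p0 else p1)) as [p ep].
  destruct (mc_factor_tcof p) as (P' & j & q & cj & wj & fq & e).
  assert (qj : forall b, pr b ∘ q ∘ j = if b then p0 else p1).
  { intro b. now rewrite <- comp_assoc, e, ep. }
  unshelve eexists
    {| path := P'; path_const := j ∘ w; path_end := fun b => pr b ∘ q |}.
  - now apply weq_comp.
  - intros b. rewrite comp_assoc, qj. now destruct b.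
  - intros A B i ci wi h v ehv. destruct (ex B v) as [v' ev'].
    destruct (mc_lift_tcof ci wi fq (u := h) (v := v')) as (l & li & ql).
    { apply un. intro b. now rewrite !comp_assoc, ev'. }
    exists l. split; [exact li|].
    intro b. rewrite <- comp_assoc, ql. apply ev'.
  - exists (j ∘ H). cbn. rewrite !comp_assoc, !qj. auto.
Qed.

Lemma good_cylinder_exists (X : E) : inhabited (GoodCylinder X).
Proof.
  destruct (left_homotopic_via (left_homotopic_refl (idm X))) as [C _]. exact (inhabits C).
Qed.

Lemma good_path_exists (W : E) : inhabited (GoodPath W).
Proof.
  destruct (right_homotopic_via (right_homotopic_refl (idm W))) as [P _]. exact (inhabits P).
Qed.

Lemma cyl_in_tcof (X : E) (C : GoodCylinder X) (b : bool) :
  tfib_projective X -> cof (cyl_in C b) /\ weq (cyl_in C b).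
Proof.
  intro lX. split.
  - apply cof_of_lifting. intros A B q fq wq u v e.
    (* [cyl_lift] needs a value on both ends; projectivity of [X] supplies the one at the end
       opposite to [b]. *)
    destruct (lX _ _ q fq wq (v ∘ cyl_in C (negb b))) as [u' eu'].
    destruct (cyl_lift C fq wq (u := fun a => if Bool.eqb a b then u else u') (v := v))
      as (h & hi & qh).
    { intros []; destruct b; cbn; auto. }
    exists h. split; [|exact qh]. rewrite hi. now destruct b.
  - exact (weq_section (cyl_weq C) (cyl_pr_in C b)).
Qed.

Lemma path_end_tfib (W : E) (P : GoodPath W) (b : bool) :
  tcof_injective W -> fib (path_end P b) /\ weq (path_end P b).
Proof.
  intro eW. split.
  - apply fib_of_lifting. intros A B i ci wi u v e.
    destruct (eW _ _ i ci wi (path_end P (negb b) ∘ u)) as [v' ev'].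
    destruct (path_lift P ci wi (h := u) (v := fun a => if Bool.eqb a b then v else v'))
      as (l & li & el).
    { intros []; destruct b; cbn; auto. }
    exists l. split; [exact li|]. rewrite el. now destruct b.
  - apply (weq_cancel_r (path_weq P)). rewrite path_end_const. apply weq_id.
Qed.

(** Lift the homotopy [g ~ h] along the first end of the cylinder, keeping its
    second end constantly [h]. *)
Lemma right_via_slide (X W : E) (C : GoodCylinder X) (P : GoodPath W) (f g h : hom X W) :
  tfib_projective X -> left_via C g f -> right_via P g h -> right_via P f h.
Proof.
  intros lX (H & h0 & h1) (K & k0 & k1).
  destruct (cyl_in_tcof C true lX) as [ci wi].
  destruct (path_lift P ci wi (h := K)
    (v := fun b => if b then H else h ∘ cyl_pr C)) as (L & l0 & el).
  { intros [].
    - congruence.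
    - rewrite <- comp_assoc, cyl_pr_in, comp_idr. exact k1. }
  exists (L ∘ cyl_in C false). rewrite !comp_assoc, !el. split; [exact h1|].
  now rewrite <- comp_assoc, cyl_pr_in, comp_idr.
Qed.

Lemma right_via_refl (X W : E) (P : GoodPath W) (f : hom X W) : right_via P f f.
Proof.
  exists (path_const P ∘ f). now rewrite !comp_assoc, !path_end_const, comp_idl.
Qed.

(** Slide the constant right homotopy from [g] to [g] along the left homotopy from [g] to [f]. *)
Lemma right_of_left (X W : E) (C : GoodCylinder X) (P : GoodPath W) (f g : hom X W) :
  tfib_projective X -> left_via C g f -> right_via P f g.
Proof. intros lX l. exact (right_via_slide lX l (right_via_refl P g)). Qed.

Lemma left_of_right (X W : E) (C : GoodCylinder X) (P : GoodPath W) (f g : hom X W) :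
  tcof_injective W -> right_via P f g -> left_via C f g.
Proof.
  intros eW (K & k0 & k1).
  destruct (path_end_tfib P true eW) as [fp wp].
  (* The end [true] of the path object is a trivial fibration, so the constant homotopy at [f] lifts
     with the constant path and [K] on the two ends of the cylinder. The end [false] of this lift
     runs from [f] to [g]. *)
  destruct (cyl_lift C fp wp (u := fun b => if b then path_const P ∘ f else K)
    (v := f ∘ cyl_pr C)) as (L & li & el).
  { intros []; rewrite <- comp_assoc, cyl_pr_in, comp_idr; [|exact k0].
    now rewrite comp_assoc, path_end_const, comp_idl. }
  exists (path_end P false ∘ L). rewrite <- !comp_assoc, !li. split; [|exact k1].
  now rewrite comp_assoc, path_end_const, comp_idl.
Qed.

Lemma left_homotopic_sym (X W : E) (f g : hom X W) :
  left_homotopic f g -> left_homotopic g f.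
Proof.
  intros (C & i0 & i1 & p & H & h). exists C, i1, i0, p, H. tauto.
Qed.

(** Glue the two cylinders along a trivial cofibration. *)
Lemma left_homotopic_trans (X W : E) (f g h : hom X W) :
  tfib_projective X -> left_homotopic f g -> left_homotopic g h -> left_homotopic f h.
Proof.
  intros lX (C & i0 & i1 & p & H & wp & e0 & e1 & h0 & h1) gh.
  destruct (left_homotopic_via gh) as (D & K & k0 & k1).
  destruct (cyl_in_tcof D true lX) as [cj wj].
  destruct (pushout_exists i1 (cyl_in D true)) as (S & a & b & eab & ex & un).
  (* [a] is a pushout of the trivial cofibration [cyl_in D true]; the lifting property passes to
     pushouts. *)
  assert (ta : cof a /\ weq a).
  { apply tcof_of_lifting. intros A B q fq u v e.
    destruct (mc_lift_tcof cj wj fq (u := u ∘ i1) (v := v ∘ b)) as (l & l1 & l2).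
    { rewrite comp_assoc, e, <- comp_assoc, eab. apply comp_assoc. }
    destruct (ex _ u l (eq_sym l1)) as (m & ma & mb).
    exists m. split; [exact ma|]. apply un; rewrite <- comp_assoc; congruence. }
  destruct (ex _ p (cyl_pr D)) as (r & ra & rb).
  { now rewrite e1, cyl_pr_in. }
  destruct (ex _ H K) as (L & La & Lb); [congruence|].
  exists S, (a ∘ i0), (b ∘ cyl_in D false), r, L.
  rewrite !comp_assoc, ra, rb, La, Lb, cyl_pr_in. repeat split; auto.
  apply (weq_cancel_r (proj2 ta)). now rewrite ra.
Qed.

Lemma left_homotopic_comp (X W V : E) (q : hom W V) (f g : hom X W) :
  left_homotopic f g -> left_homotopic (q ∘ f) (q ∘ g).
Proof.
  intros (C & i0 & i1 & p & H & wp & e0 & e1 & h0 & h1).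
  exists C, i0, i1, p, (q ∘ H). rewrite <- !(comp_assoc q). repeat split; congruence.
Qed.

Lemma left_homotopic_right (X W : E) (f g : hom X W) :
  tfib_projective X -> left_homotopic f g -> right_homotopic f g.
Proof.
  intros lX h. destruct (left_homotopic_via (left_homotopic_sym h)) as [C hC].
  destruct (good_path_exists W) as [P].
  exact (right_via_homotopic (right_of_left P lX hC)).
Qed.

Lemma left_homotopic_homotopic (X W : E) (f g : hom X W) :
  tfib_projective X -> left_homotopic f g -> homotopic f g.
Proof. intros lX h. split; [exact h | now apply left_homotopic_right]. Qed.

(** The mixed hypotheses are those of [right_via_slide]: the left homotopy moves the start of the
    right one. *)
Lemma right_homotopic_trans (X W : E) (f g h : hom X W) :
  tfib_projective X -> left_homotopic f g -> right_homotopic g h -> right_homotopic f h.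
Proof.
  intros lX fg gh. destruct (left_homotopic_via (left_homotopic_sym fg)) as [C hC].
  destruct (right_homotopic_via gh) as [P hP].
  exact (right_via_homotopic (right_via_slide lX hC hP)).
Qed.

Lemma homotopy_class_eq (X W : E) (f g : hom X W) :
  tfib_projective X -> left_homotopic f g -> homotopy_class f = homotopy_class g.
Proof.
  intros lX fg. extensionality h. apply propositional_extensionality.
  pose proof (left_homotopic_sym fg) as gf.
  split; intros [l r]; split;
    eauto using left_homotopic_trans, right_homotopic_trans.
Qed.

Lemma right_homotopic_left_via (X W : E) (C : GoodCylinder X) (f g : hom X W) :
  tcof_injective W -> right_homotopic f g -> left_via C f g.
Proof.
  intros eW h. destruct (right_homotopic_via h) as [P hP].
  exact (left_of_right C eW hP).
Qed.

(** The detour through right homotopy frees the choice of cylinder, so that homotopies into several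
    targets can share one. *)
Lemma left_homotopic_left_via (X W : E) (C : GoodCylinder X) (f g : hom X W) :
  tfib_projective X -> tcof_injective W -> left_homotopic f g -> left_via C f g.
Proof. intros lX eW h. now apply right_homotopic_left_via, left_homotopic_right. Qed.

(** The constant path at [F ∘ i] extends along [i] to a path from [F] to [G]. This right homotopy is
    composed with [u] and only then turned into a left one. *)
Lemma extension_unique (A B X W : E) (i : hom A B) (F G : hom B W) (u : hom X B) :
  cof i -> weq i -> tcof_injective W -> F ∘ i = G ∘ i -> left_homotopic (F ∘ u) (G ∘ u).
Proof.
  intros ci wi eW e. destruct (good_path_exists W) as [P].
  destruct (good_cylinder_exists X) as [C].
  apply (left_via_homotopic (C := C)), (left_of_right (P := P) C eW).
  destruct (path_lift P ci wi (h := path_const P ∘ (F ∘ i))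
    (v := fun b => if b then F else G)) as (L & _ & el).
  { intros []; rewrite comp_assoc, path_end_const, comp_idl; auto. }
  exists (L ∘ u). now rewrite !comp_assoc, !el.
Qed.

Lemma tcof_reflects (X V Z : E) (i : hom V Z) (a b : hom X V) :
  cof i -> weq i -> tcof_injective V -> left_homotopic (i ∘ a) (i ∘ b) -> left_homotopic a b.
Proof.
  (* Injectivity of [V] makes [i] a split monomorphism. *)
  intros ci wi eV h. destruct (eV _ _ i ci wi (idm V)) as [r e].
  apply (left_homotopic_comp r) in h. now rewrite !comp_assoc, e, !comp_idl in h.
Qed.

(** * Weak equivalences act bijectively on homotopy classes *)

Section WeakEquivalence.
Variables (X V W : E) (w : hom V W).
Hypothesis lX : tfib_projective X.
Hypothesis eV : tcof_injective V.
Hypothesis eW : tcof_injective W.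
Hypothesis ww : weq w.

(** Reduces [w] to a trivial cofibration and a trivial fibration, each accessible to lifting. [Z]
    inherits injectivity from [W] along the fibration [q], which is trivial by two-out-of-three. *)
Lemma weq_factor : exists (Z : E) (i : hom V Z) (q : hom Z W),
  cof i /\ weq i /\ tcof_injective Z /\ fib q /\ weq q /\ q ∘ i = w.
Proof.
  destruct (mc_factor_tcof w) as (Z & i & q & ci & wi & fq & e).
  exists Z, i, q. repeat split; auto.
  - intros A B j cj wj u. destruct (eW cj wj (q ∘ u)) as [v ev].
    destruct (mc_lift_tcof cj wj fq (u := u) (v := v)) as (h & hj & _); [auto|].
    now exists h.
  - apply (weq_cancel_r wi). now rewrite e.
Qed.

Lemma weq_reflects (a b : hom X V) : left_homotopic (w ∘ a) (w ∘ b) -> left_homotopic a b.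
Proof.
  intro h. destruct weq_factor as (Z & i & q & ci & wi & eZ & fq & wq & e).
  apply (tcof_reflects ci wi eV).
  destruct (left_homotopic_via h) as (C & H & h0 & h1).
  (* The homotopy lifts through [q] with both ends prescribed, which leaves the case of [i]. *)
  destruct (cyl_lift C fq wq (u := fun b' => if b' then i ∘ a else i ∘ b) (v := H))
    as (L & li & _).
  { intros []; rewrite comp_assoc, e; auto. }
  apply (left_via_homotopic (C := C)). exists L. now rewrite !li.
Qed.

Lemma weq_surjective (u : hom X W) : exists v : hom X V, left_homotopic (w ∘ v) u.
Proof.
  destruct weq_factor as (Z & i & q & ci & wi & eZ & fq & wq & e).
  destruct (lX fq wq u) as [z <-]. destruct (eV ci wi (idm V)) as [r er].
  (* The retraction [r] is also a homotopy inverse on the other side: [i ∘ r] and the identity agree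
     after [i]. *)
  assert (h : left_homotopic (i ∘ r ∘ z) (idm Z ∘ z)).
  { apply (extension_unique z ci wi eZ). now rewrite <- comp_assoc, er, comp_idl, comp_idr. }
  rewrite comp_idl in h.
  exists (r ∘ z). apply (left_homotopic_comp q) in h.
  rewrite !comp_assoc, e in h. now rewrite comp_assoc.
Qed.
End WeakEquivalence.

End Homotopy.

(** * Faithfulness of the localization up to homotopy *)

Section Faithful.
Variables (E : ModelCategory) (X : E).
Hypothesis lX : tfib_projective X.

Definition repl (W : E) : E :=
  proj1_sig (constructive_indefinite_description _ (fibrant_replacement W)).

Definition to_repl_sig (W : E) :=
  constructive_indefinite_description _
    (proj2_sig (constructive_indefinite_description _ (fibrant_replacement W))).

Definition to_repl (W : E) : hom W (repl W) := proj1_sig (to_repl_sig W).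

Lemma repl_spec (W : E) :
  tcof_injective (repl W) /\ cof (to_repl W) /\ weq (to_repl W).
Proof. exact (proj2_sig (to_repl_sig W)). Qed.

(** Replacements are chosen object by object, without functoriality; instead, each [f] has a
    covering map, unique up to homotopy on maps from [X]. *)
Definition covers (V W : E) (f : hom V W) (F : hom (repl V) (repl W)) : Prop :=
  F ∘ to_repl V = to_repl W ∘ f.

Lemma covers_exists (V W : E) (f : hom V W) : exists F, covers f F.
Proof.
  destruct (repl_spec V) as (_ & cV & wV), (repl_spec W) as (eW & _).
  exact (eW _ _ _ cV wV (to_repl W ∘ f)).
Qed.

Lemma covers_unique (V W : E) (f : hom V W) (F G : hom (repl V) (repl W))
    (u : hom X (repl V)) :
  covers f F -> covers f G -> left_homotopic (F ∘ u) (G ∘ u).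
Proof.
  intros hF hG. destruct (repl_spec V) as (_ & cV & wV), (repl_spec W) as (eW & _).
  apply (extension_unique u cV wV eW). congruence.
Qed.

Lemma covers_weq (V W : E) (f : hom V W) (F : hom (repl V) (repl W)) :
  covers f F -> weq f -> weq F.
Proof.
  intros hF wf. destruct (repl_spec V) as (_ & _ & wV), (repl_spec W) as (_ & _ & wW).
  apply (weq_cancel_r wV). rewrite hF. now apply weq_comp.
Qed.

(** The functor [W ↦ π(X, repl W)] inverts weak equivalences, hence acts on words;
    the action is recorded as a relation between representatives. *)
Fixpoint act (V W : E) (a : word V W) : hom X (repl V) -> hom X (repl W) -> Prop :=
  match a with
  | w_mor f => fun u v => exists F, covers f F /\ left_homotopic (F ∘ u) v
  | @w_inv _ _ _ w _ => fun u v => exists F, covers w F /\ left_homotopic (F ∘ v) u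
  | w_comp a b => fun u v => exists z, act b u z /\ act a z v
  end.

Let sym (V : E) (u v : hom X V) := @left_homotopic_sym E X V u v.
Let trans (V : E) (u v w : hom X V) := @left_homotopic_trans E X V u v w lX.

Lemma act_mor (V W : E) (f : hom V W) F u v :
  covers f F -> (act (w_mor f) u v <-> left_homotopic (F ∘ u) v).
Proof.
  intro hF. split.
  - intros (G & hG & h). exact (trans (covers_unique u hF hG) h).
  - intro h. now exists F.
Qed.

Lemma act_inv (V W : E) (w : hom V W) (ww : weq w) F u v :
  covers w F -> (act (w_inv ww) u v <-> left_homotopic (F ∘ v) u).
Proof.
  intro hF. split.
  - intros (G & hG & h). exact (trans (covers_unique v hF hG) h).
  - intro h. now exists F.
Qed.

Lemma act_idm (V : E) u v : act (w_mor (idm V)) u v <-> left_homotopic u v.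
Proof.
  rewrite <- (comp_idl u) at 2. apply act_mor. red. now rewrite comp_idl, comp_idr.
Qed.

Lemma act_homotopic (V W : E) (a : word V W) u u' v v' :
  left_homotopic u u' -> left_homotopic v v' -> act a u v -> act a u' v'.
Proof.
  revert u u' v v'.
  induction a as [V W f | V W w ww | V Z W a IHa b IHb]; intros u u' v v' hu hv.
  - intros (F & hF & h). exists F. split; [exact hF|].
    exact (trans (left_homotopic_comp F (sym hu)) (trans h hv)).
  - intros (F & hF & h). exists F. split; [exact hF|].
    exact (trans (left_homotopic_comp F (sym hv)) (trans h hu)).
  - intros (z & hb & ha). exists z. split.
    + exact (IHb _ _ _ _ hu (left_homotopic_refl z) hb).
    + exact (IHa _ _ _ _ (left_homotopic_refl z) hv ha).
Qed.

(** Most generating relations only compose homotopies. For [we_invl] the map covering [w] must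
    reflect homotopy, and for [we_invr] it must be surjective on homotopy classes. *)
Lemma act_word_eq (V W : E) (a b : word V W) :
  word_eq a b -> forall u v, act a u v <-> act b u v.
Proof.
  induction 1 as [ V W a | V W a b _ IH | V W a b c _ IH1 _ IH2
    | V Z W a a' b b' _ IHa _ IHb | V W a | V W a | T V Z W a b c
    | V Z W g f | V W w ww | V W w ww ]; intros u v.
  - reflexivity.
  - now rewrite IH.
  - now rewrite IH1, IH2.
  - cbn. split; intros (z & h1 & h2); exists z; split; try apply IHa; try apply IHb; auto.
  - split.
    + intros (z & h1 & h2). apply act_idm in h2.
      exact (act_homotopic (left_homotopic_refl u) h2 h1).
    + intro h. exists v. split; [exact h|]. apply act_idm, left_homotopic_refl.
  - split.
    + intros (z & h1 & h2). apply act_idm in h1.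
      exact (act_homotopic (sym h1) (left_homotopic_refl v) h2).
    + intro h. exists u. split; [|exact h]. apply act_idm, left_homotopic_refl.
  - cbn. split.
    + intros (z & (y & h1 & h2) & h3). eauto.
    + intros (z & h1 & y & h2 & h3). eauto.
  - destruct (covers_exists g) as [G hG], (covers_exists f) as [F hF].
    assert (hGF : covers (g ∘ f) (G ∘ F)).
    { red. rewrite <- comp_assoc, hF, comp_assoc, hG. symmetry; apply comp_assoc. }
    rewrite (act_mor u v hGF). split.
    + intros (z & h1 & h2). apply (act_mor _ _ hF) in h1. apply (act_mor _ _ hG) in h2.
      rewrite <- comp_assoc. exact (trans (left_homotopic_comp G h1) h2).
    + intro h. exists (F ∘ u). split.
      * apply (act_mor _ _ hF), left_homotopic_refl.
      * apply (act_mor _ _ hG). now rewrite comp_assoc.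
  - destruct (covers_exists w) as [F hF].
    destruct (repl_spec V) as (eV & _), (repl_spec W) as (eW & _).
    rewrite act_idm. split.
    + intros (z & h1 & h2). apply (act_mor _ _ hF) in h1. apply (act_inv _ _ _ hF) in h2.
      apply (weq_reflects eV eW (covers_weq hF ww)). exact (trans h1 (sym h2)).
    + intro h. exists (F ∘ u). split.
      * apply (act_mor _ _ hF), left_homotopic_refl.
      * apply (act_inv _ _ _ hF). apply left_homotopic_comp, sym, h.
  - destruct (covers_exists w) as [F hF].
    destruct (repl_spec V) as (eV & _), (repl_spec W) as (eW & _).
    rewrite act_idm. split.
    + intros (z & h1 & h2). apply (act_inv _ _ _ hF) in h1. apply (act_mor _ _ hF) in h2.
      exact (trans (sym h1) h2).
    + intro h.
      destruct (weq_surjective lX eV eW (covers_weq hF ww) u) as [z hz].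
      exists z. split.
      * now apply (act_inv _ _ _ hF).
      * apply (act_mor _ _ hF). exact (trans hz h).
Qed.

Lemma to_ho_homotopic (W : E) (f g : hom X W) :
  tcof_injective W -> fmap to_ho f = fmap to_ho g -> left_homotopic f g.
Proof.
  intros eW e. apply ho_class_eq in e.
  destruct (repl_spec W) as (_ & cW & wW). apply (tcof_reflects cW wW eW).
  destruct (covers_exists f) as [F hF], (covers_exists g) as [G hG].
  (* As in the Yoneda lemma, the words of [f] and [g] are evaluated on [to_repl X]; the values are
     the classes of [to_repl W ∘ f] and [to_repl W ∘ g]. *)
  pose proof (proj1 (act_word_eq e (to_repl X) (F ∘ to_repl X))
    (proj2 (act_mor _ _ hF) (left_homotopic_refl _))) as h.
  apply (act_mor _ _ hG) in h. rewrite hF, hG in h. exact (sym h).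
Qed.

End Faithful.

(** * Homotopic maps agree in the homotopy category *)

Lemma word_eq_cancel (E : ModelCategory) (X Y : E) (i : hom X Y) (p : hom Y X) :
  forall h : weq p, p ∘ i = idm X -> word_eq (w_mor i) (w_inv h).
Proof.
  intros h e.
  eapply we_trans; [apply we_sym, we_idl|].
  eapply we_trans; [apply we_comp; [apply we_sym, (we_invl h) | apply we_refl]|].
  eapply we_trans; [apply we_sym, we_assoc|].
  eapply we_trans; [apply we_comp; [apply we_refl | apply we_mor_comp]|].
  rewrite e. apply we_idr.
Qed.

Lemma left_homotopic_to_ho (E : ModelCategory) (X W : E) (f g : hom X W) :
  left_homotopic f g -> fmap to_ho f = fmap to_ho g.
Proof.
  intros (C & i0 & i1 & p & H & wp & e0 & e1 & <- & <-). apply ho_class_eq.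
  eapply we_trans; [apply we_sym, we_mor_comp|].
  eapply we_trans; [|apply we_mor_comp].
  (* Both ends of the cylinder are sections of [p], so each equals the formal inverse of [p]. *)
  apply we_comp; [apply we_refl|].
  exact (we_trans (word_eq_cancel wp e0) (we_sym (word_eq_cancel wp e1))).
Qed.

(** * Extending over the objects of degree [k] *)

Lemma endomorphism_idm (J : WeakLattice) (s : J) (f : hom s s) : f = idm s.
Proof.
  destruct (wl_lower f) as [h|h]; [|lia].
  (* Case analysis on [is_identity] needs independent endpoints; they are separated by a transport,
     which proof irrelevance then removes. *)
  assert (gen : forall (a b : J) (f : hom a b), is_identity f ->
    forall e : a = b, eq_rect a (fun b => hom a b) (idm a) b e = f).
  { intros a b f' [c] e. now rewrite (proof_irrelevance _ e eq_refl). }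
  symmetry. exact (gen _ _ _ h eq_refl).
Qed.

Section Extension.
Variables (E : ModelCategory) (J : WeakLattice) (Yt : Functor J (Ho E)).
Variables (x : J) (k : nat) (hk : k < deg x).
Hypothesis k_pos : 0 < k.
Variable Yk : Lift (restr Yt (indJk x k)).
Variable Yx : Lift (restr Yt (inJk x (k - 1))).
Hypothesis hY : agree Yk Yx.

Local Notation Y t := (fobj Yt t : ob (mcat E)).

Lemma inJk_pred (t : J) : inJk x k t -> deg t <> k -> inJk x (k - 1) t.
Proof. intros [h d] n. split; [exact h|]. destruct d; [now left | right; lia]. Qed.

Lemma indJk_of_neq (t : J) : inJk x k t -> t <> x -> indJk x k t.
Proof. now split. Qed.

Variable Z : forall g : level_ob x k, hom (Y x) (Y g).
Hypothesis Z_class : forall g, fmap to_ho (Z g) = fmap Yt (l_mor g).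
Hypothesis Z_comp : forall (g : level_ob x k) (u : under_ob (l_tgt g) k),
  @comp E _ _ _ (@lmap _ _ _ Yk (level_in hk g) (@in_boundary J x k (level_in hk g) k u) (u_mor u)) (Z g) =
  Yx_at Yx (under_comp (l_mor g) u).

(** The case [t = x] falls under the second branch, as [k < deg x]. *)
Definition ext_from (t : J) (ht : inJk x k t) (f : hom x t) : @hom E (Y x) (Y t) :=
  match Nat.eq_dec (deg t) k with
  | left e => Z (Level f e)
  | right n => @lmap _ _ _ Yx (exist _ x (inJk_self x (k - 1)))
                 (exist _ t (inJk_pred ht n)) f
  end.


Lemma ext_from_below (t : J) (ht : inJk x k t) (ht' : inJk x (k - 1) t) (f : hom x t) :
  ext_from ht f =
  @lmap _ _ _ Yx (exist _ x (inJk_self x (k - 1))) (exist _ t ht') f.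
Proof.
  unfold ext_from. destruct (Nat.eq_dec (deg t) k) as [e|n].
  (* [k_pos] matters here: with truncated subtraction, [deg t <= k - 1] excludes [deg t = k] only
     for positive [k]. *)
  - exfalso. destruct ht' as [_ [et|]]; [subst t|]; lia.
  - now rewrite (proof_irrelevance _ (inJk_pred ht n) ht').
Qed.

Lemma ext_from_level (t : J) (ht : inJk x k t) (f : hom x t) (e : deg t = k) :
  ext_from ht f = Z (Level f e).
Proof.
  unfold ext_from. destruct (Nat.eq_dec (deg t) k) as [e'|n]; [|contradiction].
  now rewrite (proof_irrelevance _ e' e).
Qed.

Lemma ext_from_class (t : J) (ht : inJk x k t) (f : hom x t) :
  fmap to_ho (ext_from ht f) = fmap Yt f.
Proof.
  destruct (Nat.eq_dec (deg t) k) as [e|n].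
  - rewrite (ext_from_level ht f e). exact (Z_class (Level f e)).
  - rewrite (ext_from_below ht (inJk_pred ht n)).
    exact (@lmap_lifts _ _ _ Yx (exist _ x _) (exist _ t _) f).
Qed.

Lemma ext_from_comp (s t : J) (hs : inJk x k s) (ht : inJk x k t)
    (ps : indJk x k s) (pt : indJk x k t) (f : hom x s) (u : hom s t) :
  @comp E _ _ _ (@lmap _ _ _ Yk (exist _ s ps) (exist _ t pt) u) (ext_from hs f) =
  ext_from ht (u ∘ f).
Proof.
  destruct (wl_lower u) as [iu|lt].
  - destruct iu as [s]. rewrite (proof_irrelevance _ pt ps), (proof_irrelevance _ ht hs), comp_idl.
    etransitivity; [|apply comp_idl].
    exact (f_equal (fun m => @comp E _ _ _ m (ext_from hs f)) (lmap_id Yk (exist _ s ps))).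
  - assert (dt : deg t < k).
    { destruct ps as [[_ [e|]] n]; [contradiction | lia]. }
    assert (ht' : inJk x (k - 1) t) by (apply inJk_pred; [exact ht | lia]).
    rewrite (ext_from_below ht ht').
    (* If [s] has degree [k], the claim is [Z_comp]; otherwise every map involved comes from [Yx],
       by [hY] and functoriality. *)
    destruct (Nat.eq_dec (deg s) k) as [e|n].
    + rewrite (ext_from_level hs f e).
      pose proof (@Z_comp (Level f e) (@Under J s k t u dt)) as h. cbn in h.
      unfold in_boundary, level_in, Yx_at in h. cbn in h.
      rewrite (proof_irrelevance _ (indJk_level hk (Level f e)) ps) in h.
      rewrite (proof_irrelevance _ pt (indJk_closed u ps)).
      rewrite (proof_irrelevance _ ht' (inJk_under (under_comp f (@Under J s k t u dt)))).
      exact h.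
    + rewrite (ext_from_below hs (inJk_pred hs n)).
      rewrite (hY ps pt (inJk_pred hs n) ht').
      symmetry. exact (@lmap_comp _ _ _ Yx (exist _ x _) (exist _ s _) (exist _ t _) u f).
Qed.

(** A morphism whose source is not [x] stays in the boundary by [indJk_closed], so two branches
    cover all cases. *)
Definition ext_map (s t : J) (hs : inJk x k s) (ht : inJk x k t) (f : hom s t) :
    @hom E (Y s) (Y t) :=
  match excluded_middle_informative (s = x) with
  | left e =>
      eq_rect_r (fun s => hom s t -> @hom E (Y s) (Y t)) (fun f => ext_from ht f) e f
  | right n => @lmap _ _ _ Yk (exist _ s (indJk_of_neq hs n))
       (exist _ t (indJk_closed f (indJk_of_neq hs n))) f
  end.

Lemma ext_map_from (t : J) (hs : inJk x k x) (ht : inJk x k t) (f : hom x t) :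
  ext_map hs ht f = ext_from ht f.
Proof.
  unfold ext_map. destruct (excluded_middle_informative (x = x)) as [e|n]; [|contradiction].
  now rewrite (proof_irrelevance _ e eq_refl).
Qed.

Lemma ext_map_boundary (s t : J) (hs : inJk x k s) (ht : inJk x k t)
    (ps : indJk x k s) (pt : indJk x k t) (f : hom s t) :
  ext_map hs ht f = @lmap _ _ _ Yk (exist _ s ps) (exist _ t pt) f.
Proof.
  unfold ext_map. destruct (excluded_middle_informative (s = x)) as [e|n].
  - exfalso. exact (proj2 ps e).
  - now rewrite (proof_irrelevance _ (indJk_of_neq hs n) ps),
      (proof_irrelevance _ (indJk_closed f ps) pt).
Qed.

Lemma ext_from_idm (hx : inJk x k x) : ext_from hx (idm x) = idm (Y x).
Proof.
  rewrite (ext_from_below hx (inJk_self x (k - 1))).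
  exact (lmap_id Yx (exist _ x (inJk_self x (k - 1)))).
Qed.

Definition extension : Lift (restr Yt (inJk x k)).
Proof.
  refine (@Build_Lift E (full (inJk x k)) (restr Yt (inJk x k))
    (fun s t f => ext_map (proj2_sig s) (proj2_sig t) f) _ _ _).
  - intros [s hs]. cbn. destruct (classic (s = x)) as [->|n].
    + rewrite ext_map_from. apply ext_from_idm.
    + rewrite (ext_map_boundary _ _ (indJk_of_neq hs n) (indJk_of_neq hs n)).
      exact (lmap_id Yk (exist _ s (indJk_of_neq hs n))).
  - intros [s hs] [t ht] [u hu] g f. cbn in *.
    assert (closed : forall a b (h : hom a b), inJk x k a -> a <> x -> indJk x k b).
    { intros a b h ha n. exact (indJk_closed h (indJk_of_neq ha n)). }
    destruct (classic (s = x)) as [->|n].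
    + rewrite !ext_map_from. destruct (classic (t = x)) as [->|n].
      * rewrite ext_map_from, (endomorphism_idm f), comp_idr, (proof_irrelevance _ ht hs).
        rewrite ext_from_idm. symmetry; apply comp_idr.
      * rewrite (ext_map_boundary ht hu (indJk_of_neq ht n) (closed _ _ g ht n)).
        symmetry; apply ext_from_comp.
    + pose proof (closed _ _ f hs n) as pt. pose proof (closed _ _ g ht (proj2 pt)) as pu.
      rewrite (ext_map_boundary hs hu (indJk_of_neq hs n) pu),
        (ext_map_boundary ht hu pt pu), (ext_map_boundary hs ht (indJk_of_neq hs n) pt).
      exact (@lmap_comp _ _ _ Yk (exist _ s _) (exist _ t _) (exist _ u _) g f).
  - intros [s hs] [t ht] f. cbn in *. destruct (classic (s = x)) as [->|n].
    + rewrite ext_map_from. apply ext_from_class.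
    + rewrite (ext_map_boundary hs ht (indJk_of_neq hs n)
        (indJk_closed f (indJk_of_neq hs n))).
      exact (@lmap_lifts _ _ _ Yk (exist _ s _) (exist _ t _) f).
Defined.

Lemma extension_exists :
  exists Y : Lift (restr Yt (inJk x k)), agree Y Yk /\ agree Y Yx.
Proof.
  exists extension. split; intros s t ps pt qs qt f; cbn.
  - apply ext_map_boundary.
  - destruct (classic (s = x)) as [->|n].
    + rewrite ext_map_from, (proof_irrelevance _ qs (inJk_self x (k - 1))).
      apply ext_from_below.
    + rewrite (ext_map_boundary ps pt (indJk_of_neq ps n)
        (indJk_closed f (indJk_of_neq ps n))). apply hY.
Qed.

End Extension.

(** * The obstruction *)

Section ProductMaps.
Variables (C : Category) (I : Type) (A A' : I -> C).
Variables (P : Product A) (P' : Product A') (f : forall i, hom (A i) (A' i)).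

Lemma proj_prod_map (i : I) (Z : C) (u : hom Z P) :
  proj P' i ∘ (prod_map P P' f ∘ u) = f i ∘ (proj P i ∘ u).
Proof. unfold prod_map. now rewrite proj_pair_comp, comp_assoc. Qed.

Lemma prod_map_pair (Z : C) (u : forall i, hom Z (A i)) :
  prod_map P P' f ∘ pair_map P u = pair_map P' (fun i => f i ∘ u i).
Proof.
  apply pair_map_unique. intro i. now rewrite proj_prod_map, !proj_pair_map.
Qed.

Lemma prod_map_mono (Z : C) (u v : hom Z P) :
  (forall i (a b : hom Z (A i)), f i ∘ a = f i ∘ b -> a = b) ->
  prod_map P P' f ∘ u = prod_map P P' f ∘ v -> u = v.
Proof.
  intros m e. apply pair_map_unique. intro i. apply m.
  now rewrite <- !proj_prod_map, e.
Qed.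

End ProductMaps.

Section Obstruction.
Variables (E : ModelCategory) (J : WeakLattice) (Yt : Functor J (Ho E)).
Variables (x : J) (k : nat) (hk : k < deg x).
Variable Yk : Lift (restr Yt (indJk x k)).
Variable Yx : Lift (restr Yt (inJk x (k - 1))).
Variable c : Choices hk Yk.

Local Notation Y t := (fobj Yt t : ob (mcat E)).

(** The components of [forget] are the legs of the limit, which are jointly monic. *)
Lemma forget_mono (s : full (indJk x k)) (Z : E) (u v : hom Z (ch_match c s)) :
  forget (ch_match c s) (ch_inner c s) ∘ u = forget (ch_match c s) (ch_inner c s) ∘ v ->
  u = v.
Proof.
  intro e. apply lim_map_unique. intro d.
  apply (f_equal (comp (proj (ch_inner c s) d))) in e. unfold forget in e.
  now rewrite !(@proj_pair_comp _ _ _ (ch_inner c s)) in e.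
Qed.

Lemma prod_forget_mono (Z : E) (u v : hom Z (ch_prodM c)) :
  prod_forget c ∘ u = prod_forget c ∘ v -> u = v.
Proof.
  apply prod_map_mono. intros g a b. apply forget_mono.
Qed.

Definition prod_matching : hom (ch_level c) (ch_prodM c) :=
  prod_map (ch_level c) (ch_prodM c)
    (fun g => matching_map (ch_match c (level_in hk g))).

Lemma prod_forget_matching : prod_forget c ∘ prod_matching = prod_sigma c.
Proof.
  etransitivity; [apply prod_map_pair|]. unfold prod_sigma, prod_map. f_equal.
  extensionality g. rewrite comp_assoc. unfold sigma_at. f_equal.
  apply pair_map_unique; intro u.
  etransitivity; [apply (@proj_pair_comp _ _ _ (ch_inner c (level_in hk g)))|].
  etransitivity; [|symmetry; apply (@proj_pair_map _ _ _ (ch_inner c (level_in hk g)))].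
  apply (leg_lim_map (ch_match c (level_in hk g))).
Qed.

Lemma matching_map_fib (g : level_ob x k) :
  reedy_fibrant Yk -> fib (matching_map (ch_match c (level_in hk g))).
Proof.
  intro h.
  (* [Choices] bounds the matching objects by [k], Reedy fibrancy by the degree of [s]. The bound is
     generalised before the two are identified. *)
  assert (gen : forall (s : full (indJk x k)) j, j = deg (proj1_sig s) ->
    forall M : Limit (matching_diagram Yk s j), fib (matching_map M)).
  { intros s j ->. apply h. }
  apply gen. symmetry. apply l_deg.
Qed.

Hypothesis hY : agree Yk Yx.

(** Maps into a matching object are compared on its legs. This trades the condition on matching maps
    for the hypothesis [Z_comp] of the extension. *)
Lemma rho_matching (g : level_ob x k) (z : hom (Y x) (Y g)) :
  matching_map (ch_match c (level_in hk g)) ∘ z = rho hY c g <->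
  forall u : under_ob (l_tgt g) k,
    @comp E _ _ _ (@lmap _ _ _ Yk (level_in hk g)
      (@in_boundary J x k (level_in hk g) k u) (u_mor u)) z =
    Yx_at Yx (under_comp (l_mor g) u).
Proof.
  assert (e1 : forall u, leg (ch_match c (level_in hk g)) u ∘
      (matching_map (ch_match c (level_in hk g)) ∘ z) =
      @comp E _ _ _ (@lmap _ _ _ Yk (level_in hk g)
        (@in_boundary J x k (level_in hk g) k u) (u_mor u)) z).
  { intro u. rewrite comp_assoc.
    exact (f_equal (fun m => m ∘ z) (leg_lim_map (ch_match c (level_in hk g)) _ u)). }
  assert (e2 : forall u, leg (ch_match c (level_in hk g)) u ∘ rho hY c g =
      Yx_at Yx (under_comp (l_mor g) u)).
  { intro u. exact (leg_lim_map (ch_match c (level_in hk g)) _ u). }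
  split.
  - intros e u. rewrite <- e1, <- e2. now rewrite e.
  - intro e. apply lim_map_unique. intro u.
    etransitivity; [apply e1|]. etransitivity; [apply e|]. symmetry. apply e2.
Qed.

Variable Q : Pullback (Psi c) (prod_forget c).
Variable F1 : TCofFibFactorization (Psi c).
Variable F2 : Pullback (fac_fib F1) (prod_forget c).
Variable sigma_k : hom (Y x) (ch_level c).

Lemma pb_snd_gamma_eta :
  pb_snd F2 ∘ (gamma F2 Q ∘ eta hY Q) = pair_map (ch_prodM c) (rho hY c).
Proof.
  rewrite comp_assoc. unfold gamma. rewrite (pb_snd_map F2).
  apply (pb_snd_map Q).
Qed.

Lemma pb_fst_gamma_eta :
  pb_fst F2 ∘ (gamma F2 Q ∘ eta hY Q) = fac_tcof F1 ∘ sigma_below Yx c.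
Proof.
  rewrite comp_assoc. unfold gamma. rewrite (pb_fst_map F2), <- comp_assoc.
  f_equal. apply (pb_fst_map Q).
Qed.

Lemma snd_eq_iff (theta : hom (Y x) F2) :
  fac_fib F1 ∘ pb_fst F2 ∘ theta = prod_sigma c ∘ sigma_k <->
  pb_snd F2 ∘ theta = prod_matching ∘ sigma_k.
Proof.
  rewrite pb_square, <- prod_forget_matching, <- !comp_assoc. split.
  - apply prod_forget_mono.
  - intro e. now rewrite e.
Qed.

End Obstruction.

(** * Fibrations, products and homotopies *)

Lemma fib_lift_homotopy (E : ModelCategory) (X V W : E) (q : hom V W) (f : hom X V) (g : hom X W) :
  tfib_projective X -> fib q -> left_homotopic (q ∘ f) g ->
  exists f', left_homotopic f f' /\ q ∘ f' = g.
Proof.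
  intros lX fq h. destruct (left_homotopic_via h) as (C & H & h0 & h1).
  destruct (cyl_in_tcof C true lX) as [ci wi].
  (* Covering homotopy: [H] lifts along [q] starting from [f], and the end of the lift is the
     required [f']. *)
  destruct (mc_lift_tcof ci wi fq (u := f) (v := H)) as (K & k0 & k1); [now symmetry|].
  exists (K ∘ cyl_in C false). split.
  - apply (left_via_homotopic (C := C)). now exists K.
  - now rewrite comp_assoc, k1.
Qed.

Lemma fib_pullback (E : ModelCategory) (A B S : E) (a : hom A S) (b : hom B S)
    (P : Pullback a b) : fib a -> fib (pb_snd P).
Proof.
  intro fa. apply fib_of_lifting. intros X Y i ci wi u v e.
  destruct (mc_lift_tcof ci wi fa (u := pb_fst P ∘ u) (v := b ∘ v)) as (h & hi & ah).
  { now rewrite comp_assoc, pb_square, <- !comp_assoc, e. }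
  exists (pb_map P h v ah). split; [|apply pb_snd_map].
  apply pb_map_unique; now rewrite comp_assoc, ?pb_fst_map, ?pb_snd_map.
Qed.

Lemma dependent_functional_choice (I : Type) (B : I -> Type) (R : forall i, B i -> Prop) :
  (forall i, exists b, R i b) -> exists f : forall i, B i, forall i, R i (f i).
Proof.
  intro h. exists (fun i => proj1_sig (constructive_indefinite_description _ (h i))).
  intro i. apply proj2_sig.
Qed.

(** The componentwise homotopies are moved to one common cylinder, where they can be paired. *)
Lemma left_homotopic_product (E : ModelCategory) (I : Type) (A : I -> E)
    (P : Product A) (X : E) (f g : hom X P) :
  tfib_projective X -> (forall i, tcof_injective (A i)) ->
  (forall i, left_homotopic (proj P i ∘ f) (proj P i ∘ g)) -> left_homotopic f g.
Proof.
  intros lX eA hfg. destruct (good_cylinder_exists X) as [C].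
  destruct (dependent_functional_choice (fun i => left_homotopic_left_via C lX (eA i) (hfg i)))
    as [h hh].
  apply (left_via_homotopic (C := C)). exists (pair_map P h).
  split; apply pair_map_unique; intro i; rewrite proj_pair_comp; apply hh.
Qed.

Theorem proposition3p18
  (E : ModelCategory) (J : WeakLattice) (Yt : Functor J (Ho E))
  (hYt : forall s : J, @fibrant E (Yt s) /\ @cofibrant E (Yt s))
  (x : J) (n k : nat) (hn : n < deg x) (hkn : k <= n) (hk2 : 2 <= k)
  (Yk : Lift (restr Yt (indJk x k)))
  (hYk : reedy_fibrant Yk)
  (Yx : Lift (restr Yt (inJk x (k - 1))))
  (hY : agree Yk Yx)
  (c : Choices (Nat.le_lt_trans _ _ _ hkn hn) Yk)
  (sigma_k : @hom E (Yt x) (ch_level c))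
  (hsigma : represents sigma_k)
  (Q : Pullback (Psi c) (prod_forget c))
  (F1 : TCofFibFactorization (Psi c))
  (F2 : Pullback (fac_fib F1) (prod_forget c)) :
  (exists Y : Lift (restr Yt (inJk x k)), agree Y Yk /\ agree Y Yx) <->
  vanishes hY F2 sigma_k Q.
Proof.
  set (hk := Nat.le_lt_trans k n (deg x) hkn hn) in *.
  pose proof (cofibrant_projective (proj2 (hYt x))) as lX.
  split.
  - intros (Y & aYk & aYx).
    set (z := fun g : level_ob x k => @lmap _ _ _ Y (exist _ x (inJk_self x k))
      (exist _ (l_tgt g) (proj1 (indJk_level hk g))) (l_mor g)).
    assert (zrho : forall g,
        @comp E _ _ _ (matching_map (ch_match c (level_in hk g))) (z g) = rho hY c g).
    { intro g. apply rho_matching. intro u. unfold z, Yx_at.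
      pose proof (proj2_sig (@in_boundary J x k (level_in hk g) k u)) as bu.
      etransitivity; [|apply (aYx _ _ (inJk_self x k) (proj1 bu))].
      etransitivity; [apply (f_equal (fun m => @comp E _ _ _ m _)); symmetry;
        apply (aYk _ _ (proj1 (indJk_level hk g)) (proj1 bu))|].
      symmetry. apply (@lmap_comp _ _ _ Y (exist _ x _) (exist _ (l_tgt g) _)
        (exist _ (u_tgt u) _)). }
    (* Classes are prescribed for each component only, so the homotopy is assembled from those of
       the components. *)
    assert (hz : left_homotopic (pair_map (ch_level c) z) sigma_k).
    { apply (left_homotopic_product lX).
      { intro g. exact (fibrant_injective (proj1 (hYt g))). }
      intro g. apply (to_ho_homotopic lX (fibrant_injective (proj1 (hYt g)))).
      etransitivity; [apply (f_equal (fmap to_ho)), (proj_pair_map (ch_level c))|].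
      etransitivity; [|symmetry; apply (hsigma g)].
      exact (@lmap_lifts _ _ _ Y (exist _ x _) (exist _ (l_tgt g) _) (l_mor g)). }
    assert (e : @comp E _ _ _ (prod_matching c) (pair_map (ch_level c) z) =
                @comp E _ _ _ (pb_snd F2) (@comp E _ _ _ (gamma F2 Q) (eta hY Q))).
    { rewrite pb_snd_gamma_eta. etransitivity; [apply prod_map_pair|].
      f_equal. extensionality g. apply zrho. }
    apply (left_homotopic_comp (prod_matching c)) in hz. rewrite e in hz.
    destruct (fib_lift_homotopy lX (fib_pullback F2 (fac_fibP F1)) hz)
      as (theta & htheta & snd_theta).
    exists theta. split; [|split].
    (* The first component of [gamma ∘ eta] is exactly [fac_tcof F1 ∘ sigma_below], so [theta]
       satisfies this condition up to homotopy. *)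
    + rewrite <- (pb_fst_gamma_eta hY Q F2).
      apply (left_homotopic_homotopic lX), left_homotopic_comp, left_homotopic_sym, htheta.
    + now apply snd_eq_iff.
    + exact (homotopy_class_eq lX htheta).
  - intros (theta & _ & snd_theta & cls).
    apply snd_eq_iff in snd_theta.
    set (ge := @comp E _ _ _ (gamma F2 Q) (eta hY Q)) in *.
    assert (ht : left_homotopic theta ge).
    (* The equality [cls] of predicates is evaluated at [ge], which lies in its own class. *)
    { assert (r : homotopy_class ge ge).
      { apply (left_homotopic_homotopic lX), left_homotopic_refl. }
      rewrite cls in r. apply r. }
    apply (left_homotopic_comp (pb_snd F2)) in ht. unfold ge in ht.
    rewrite snd_theta, pb_snd_gamma_eta in ht.
    assert (hz : forall g : level_ob x k, exists z,
        left_homotopic (@comp E _ _ _ (proj (ch_level c) g) sigma_k) z /\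
        @comp E _ _ _ (matching_map (ch_match c (level_in hk g))) z = rho hY c g).
    { intro g. apply (fib_lift_homotopy lX (matching_map_fib c g hYk)).
      apply (left_homotopic_comp (proj (ch_prodM c) g)) in ht.
      rewrite (proj_pair_map (ch_prodM c)) in ht.
      unfold prod_matching in ht. now rewrite (proj_prod_map (ch_prodM c)) in ht. }
    apply dependent_functional_choice in hz. destruct hz as [z hz].
    apply (@extension_exists E J Yt x k hk ltac:(lia) Yk Yx hY z).
    (* The deformation from the component of [sigma_k] to [z g] is a homotopy, so the represented
       class is unchanged. *)
    + intro g. rewrite <- (hsigma g). symmetry. apply left_homotopic_to_ho, hz.
    + intro g. apply (rho_matching c hY), hz.
Qed.
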